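(* Let $X$ be a standardized abelian Cayley graph with an associated Heuberger matrix of size $2\times 2$ or $3\times 2$, and suppose that $X$ does not have loops. Then $X$ is $4$-colorable if and only if it does not contain a $5$-clique (a complete graph $K_5$) as a subgraph; and $X$ is $3$-colorable if and only if it contains as a subgraph neither a diamond lanyard nor a copy of $C_{13}(1,5)=\mathrm{Cay}(\mathbb{Z}_{13},\{\pm 1,\pm 5\})$.
   Context: For an $m\times r$ integer matrix $M$, let $H\subseteq\mathbb{Z}^m$ be the subgroup generated by the columns of $M$, let $e_1,\dots,e_m$ be the standard basis of $\mathbb{Z}^m$, and let $S=\{H\pm e_1,\dots,H\pm e_m\}\subseteq \mathbb{Z}^m/H$. The standardized abelian Cayley graph with (associated) Heuberger matrix $M$ is the Cayley graph $\mathrm{Cay}(\mathbb{Z}^m/H,S)$: its vertices are the elements of $\mathbb{Z}^m/H$, and $x,y$ are adjacent if and only if $y-x\in S$. It has loops if and only if $e_j\in H$ for some $j$. A diamond is a graph with $4$ vertices in which exactly one pair of distinct vertices is nonadjacent (a $K_4$ with one edge deleted); those two nonadjacent vertices are its endpoints. An unclasped diamond lanyard of length $1$ is a diamond. Recursively, an unclasped diamond lanyard $U$ of length $\ell+1$ is the union of an unclasped diamond lanyard $Y$ of length $\ell$ and a diamond $D$ such that $Y$ and $D$ have exactly one endpoint in common; the endpoints of $U$ are the endpoint of $Y$ that is not an endpoint of $D$ and the endpoint of $D$ that is not an endpoint of $Y$. (The diamonds are allowed to share other vertices and edges.) A (clasped) diamond lanyard of length $\ell$ is obtained from an unclasped diamond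 lanyard $U$ of length $\ell$ by adding an edge between the endpoints of $U$. Subgraphs need not be induced. *)

(* Defs.v *)
From HB Require Import structures.
From mathcomp Require Import all_boot all_order all_algebra.
From mathcomp Require Import boolp classical_sets cardinality.

Set Implicit Arguments.
Unset Strict Implicit.
Unset Printing Implicit Defensive.

Import GRing.Theory.
Local Open Scope ring_scope.
Local Open Scope classical_set_scope.

(* Undirected graphs, loops allowed, whose vertices form a (possibly infinite)
   set of points of an ambient type; the ambient type is what makes unions and
   non-induced subgraphs literal. *)
Record graph (V : Type) := Graph {
  vert : set V;
  adj : V -> V -> Prop;
  adj_sym : forall x y, adj x y -> adj y x;
  adj_vert : forall x y, adj x y -> vert x }.

Definition loopless (V : Type) (G : graph V) := forall x, ~ adj G x x.

Definition colorable (V : Type) (k : nat) (G : graph V) :=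
  exists c : V -> 'I_k, forall x y, adj G x y -> c x <> c y.

Definition subgraph (V : Type) (G K : graph V) :=
  vert G `<=` vert K /\ forall x y, adj G x y -> adj K x y.

(* [K] has a (not necessarily induced) subgraph isomorphic to [G]. *)
Definition contains_copy (V W : Type) (G : graph V) (K : graph W) :=
  exists f : V -> W,
    [/\ forall x, vert G x -> vert K (f x),
        forall x y, vert G x -> vert G y -> f x = f y -> x = y
      & forall x y, adj G x y -> adj K (f x) (f y)].

Section Constructions.
Variable V : Type.

Lemma union_sym (G K : graph V) x y :
  adj G x y \/ adj K x y -> adj G y x \/ adj K y x.
Proof. by case=> e; [left | right]; apply: adj_sym. Qed.

Lemma union_vert (G K : graph V) x y :
  adj G x y \/ adj K x y -> (vert G `|` vert K) x.
Proof. by case=> e; [left | right]; apply: adj_vert e. Qed.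

Definition graph_union (G K : graph V) : graph V :=
  Graph (@union_sym G K) (@union_vert G K).

Lemma edge_sym (a b x y : V) :
  (x = a /\ y = b) \/ (x = b /\ y = a) -> (y = a /\ x = b) \/ (y = b /\ x = a).
Proof. by case=> -[-> ->]; [right | left]. Qed.

Lemma edge_vert (a b x y : V) :
  (x = a /\ y = b) \/ (x = b /\ y = a) -> [set a; b] x.
Proof. by case=> -[-> _]; [left | right]. Qed.

Definition edge_graph (a b : V) : graph V :=
  Graph (@edge_sym a b) (@edge_vert a b).

Definition add_edge (G : graph V) (a b : V) : graph V :=
  graph_union G (edge_graph a b).

Lemma complete_sym (x y : V) : x <> y -> y <> x.
Proof. by move=> nxy /esym. Qed.

Lemma complete_vert (x y : V) : x <> y -> [set: V] x.
Proof. by []. Qed.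

Definition complete_graph : graph V := Graph complete_sym complete_vert.

(* [diamond D E]: [D] is a diamond whose set of endpoints is [E]. *)
Definition diamond (D : graph V) (E : set V) :=
  (vert D #= `I_4)%card /\
  exists x y, [/\ vert D x, vert D y, x <> y, E = [set x; y] &
    forall u v, vert D u -> vert D v ->
      (adj D u v <-> u <> v /\ [set u; v] <> [set x; y])].

(* [unclasped_lanyard l U E]: [U] is an unclasped diamond lanyard of length [l]
   whose set of endpoints is [E]. *)
Inductive unclasped_lanyard : nat -> graph V -> set V -> Prop :=
| unclasped_diamond D E : diamond D E -> unclasped_lanyard 1 D E
| unclasped_step l Y E D F z :
    unclasped_lanyard l Y E -> diamond D F -> E `&` F = [set z] ->
    unclasped_lanyard l.+1 (graph_union Y D) ((E `\` F) `|` (F `\` E)).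

Inductive diamond_lanyard : nat -> graph V -> Prop :=
| clasp l U x y : unclasped_lanyard l U [set x; y] ->
    diamond_lanyard l (add_edge U x y).

Definition contains_diamond_lanyard (G : graph V) :=
  exists l L, diamond_lanyard l L /\ subgraph L G.

End Constructions.

Section Cayley.
Variable G : zmodType.

Definition pm_set (A : set G) : set G := A `|` [set - a | a in A].

(* The connection set is always of the form [pm_set A], hence symmetric. *)
Lemma cayley_sym (A : set G) (x y : G) :
  pm_set A (y - x) -> pm_set A (x - y).
Proof.
case=> [Ayx | [a Aa ayx]]; first by right; exists (y - x); rewrite ?opprB.
by left; rewrite -(opprB y x) -ayx opprK.
Qed.

Lemma cayley_vert (A : set G) (x y : G) : pm_set A (y - x) -> [set: G] x.
Proof. by []. Qed.

Definition cayley_graph (A : set G) : graph G :=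
  Graph (@cayley_sym A) (@cayley_vert A).

End Cayley.

Definition C13_1_5 : graph 'Z_13 := cayley_graph [set 1; 5].

Section Heuberger.
Variables (m r : nat) (M : 'M[int]_(m, r)).

Definition col_subgroup : {pred 'cV[int]_m} :=
  fun v => `[< inIntSpan [tuple col j M | j < r] v >].

Lemma col_subgroup_zmod : zmod_closed col_subgroup.
Proof.
split=> [|u v /asboolP[a ->] /asboolP[b ->]]; apply/asboolP.
  by exists [ffun=> 0]; rewrite big1 // => i _; rewrite ffunE mulr0z.
exists [ffun i => a i - b i]; rewrite -sumrB; apply: eq_bigr => i _.
by rewrite ffunE mulrzBr.
Qed.

HB.instance Definition _ :=
  GRing.isZmodClosed.Build 'cV[int]_m col_subgroup col_subgroup_zmod.

Definition heuberger_group : zmodType := Quotient.quot col_subgroup.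

(* The coset of the [j]-th standard basis vector. *)
Definition basis_coset (j : 'I_m) : heuberger_group :=
  (\pi_(Quotient.quot col_subgroup) (delta_mx j 0 : 'cV[int]_m))%qT.

Definition heuberger_graph : graph heuberger_group :=
  cayley_graph (range basis_coset).

End Heuberger.

(* Main.v *)
Require Import Defs.
From mathcomp Require Import all_boot all_order all_algebra.
From mathcomp Require Import zify ring boolp classical_sets functions cardinality.

(** A 3-coloring of a quotient of [Z^3] by a lattice [H] lifts to an integer
    height function on [Z^3] that changes by 1 along every edge. Conversely, a
    homomorphism [phi : H -> 3 Z] that has the parity of the sum of coordinates
    and satisfies [|phi u| <= |u|_1] extends to such a height function, namely
    [h x = min_(u in H) (phi u + |x - u|_1)], which is then a coloring modulo 3.
    For a basis of [H] that minimizes the sum of the 1-norms, such a [phi] with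
    values in [{0, 3, -3}] on the basis exists unless a basis vector is, up to signs
    and order, [(1, 1, 1)] or [(2, 1, 0)], or the basis is that of [C_13(1, 5)].
    A short vector produces triangles, and the endpoint displacements of the
    resulting diamonds generate a subgroup which, when there is no 3-coloring,
    contains an element of the connection set: this closes a lanyard. In these
    cases the graph either maps homomorphically to a circulant graph
    [C_N(1, 2)] that is 4-colorable, or contains [C_5(1, 2)], which is [K_5].
    A plane lattice is treated as a lattice in [Z^3] with a trivial third
    generator. *)

Set Implicit Arguments.
Unset Strict Implicit.
Unset Printing Implicit Defensive.

Import Order.TTheory GRing.Theory Num.Theory.
Local Open Scope ring_scope.

(** * Bounded functionals on lattices of rank two *)

Definition norm3 (x y z : int) : int := `|x| + `|y| + `|z|.

(* [3 * p] and [3 * q] are the values of [phi] on the two lattice vectors. *)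
Definition functional (x1 y1 z1 x2 y2 z2 p q : int) :=
  [/\ exists k, x1 + y1 + z1 = p + 2 * k, exists k, x2 + y2 + z2 = q + 2 * k
    & forall m n, 3 * `|m * p + n * q|
        <= norm3 (m * x1 + n * x2) (m * y1 + n * y2) (m * z1 + n * z2)].

(** Add two triangle inequalities: [m * a] is [m * a - n * x] plus [n * x], and [m * (a - x)] is
    [m * a - n * x] minus [(m - n) * x]. *)
Lemma norm_near (a x m n : int) : 0 <= n -> n <= m ->
  m * (`|a| + `|a - x| - `|x|) <= 2 * `|m * a - n * x|.
Proof. by nia. Qed.

(** Here [n * (a - x)] is the sum of [m * a - n * x] and [(n - m) * a]. *)
Lemma norm_far (a x m n : int) : 0 <= m -> m <= n ->
  n * `|a - x| <= `|m * a - n * x| + (n - m) * `|a|.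
Proof. by nia. Qed.

Lemma odd_vector_aux (a b c x y z m n : int) : 0 <= m -> 0 <= n ->
  norm3 x y z <= norm3 (a - x) (b - y) (c - z) ->
  norm3 a b c <= norm3 (a - x) (b - y) (c - z) ->
  5 <= norm3 a b c -> (exists k, a + b + c = 1 + 2 * k) ->
  3 * m <= norm3 (m * a - n * x) (m * b - n * y) (m * c - n * z).
Proof.
rewrite /norm3 => m0 n0 H1 H2 H3 [k H4]; have [nm|mn] := leP n m.
  have := norm_near a x n0 nm; have := norm_near b y n0 nm.
  have := norm_near c z n0 nm.
  set A := _ - `|z|; set B := _ - `|y|; set C := _ - `|x|.
  (* This sum is even and at least [norm3 a b c], which is at least 5. *)
  have : 6 <= A + B + C by rewrite /A /B /C; lia.
  move=> /(ler_wpM2l (le_trans n0 nm)).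
  move: (A) (B) (C) (`|m * a - n * x|) (`|m * b - n * y|) (`|m * c - n * z|).
  clear; lia.
have := norm_far a x m0 (ltW mn); have := norm_far b y m0 (ltW mn).
have := norm_far c z m0 (ltW mn).
have := ler_wpM2l n0 H2; have := ler_wpM2l m0 H3.
move: (`|a|) (`|b|) (`|c|) (`|a - x|) (`|b - y|) (`|c - z|).
move: (`|m * a - n * x|) (`|m * b - n * y|) (`|m * c - n * z|).
clear -m0; lia.
Qed.

(** This is the functional with values 3 and 0. Reducedness with respect to both the sum and the
    difference covers all sign patterns of [m] and [n]. *)
Lemma odd_vector (a b c x y z m n : int) :
  norm3 x y z <= norm3 (a - x) (b - y) (c - z) ->
  norm3 a b c <= norm3 (a - x) (b - y) (c - z) ->
  norm3 x y z <= norm3 (a + x) (b + y) (c + z) ->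
  norm3 a b c <= norm3 (a + x) (b + y) (c + z) ->
  5 <= norm3 a b c -> (exists k, a + b + c = 1 + 2 * k) ->
  3 * `|m| <= norm3 (m * a + n * x) (m * b + n * y) (m * c + n * z).
Proof.
move=> H1 H2 H3 H4 H5 H6.
have P := @odd_vector_aux a b c x y z `|m| `|n| (normr_ge0 _) (normr_ge0 _)
  H1 H2 H5 H6.
have := @odd_vector_aux a b c (- x) (- y) (- z) `|m| `|n| (normr_ge0 _)
  (normr_ge0 _).
rewrite !opprK => /(_ _ H4 H5 H6); rewrite {1}/norm3 !normrN => /(_ H3).
move: P; rewrite /norm3; clear.
case: (lerP 0 m) => hm; case: (lerP 0 n) => hn;
  rewrite ?(ger0_norm hm) ?(ltr0_norm hm) ?(ger0_norm hn) ?(ltr0_norm hn); lia.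
Qed.

(** * Two basis vectors with odd coordinate sums *)

Lemma norm_linear (a x m n : int) : 0 <= n -> n <= m ->
  `|a + x| = `|a| + `|x| \/ `|x| <= `|a| ->
  `|m * a + n * x| = (m - n) * `|a| + n * `|a + x|.
Proof. by nia. Qed.

Lemma norm_opposite (a x m n : int) : 0 <= n -> n <= m ->
  `|a + x| < `|a| + `|x| -> `|m * a + n * x| = `|m * `|a| - n * `|x| |.
Proof. by nia. Qed.

Lemma norm_addsub (a x : int) :
  `|a + x| = `|a| + `|x| /\ `|a - x| = `|(`|a| - `|x|)| \/
  `|a - x| = `|a| + `|x| /\ `|a + x| = `|(`|a| - `|x|)|.
Proof. by lia. Qed.

(* The only configuration, up to the order of coordinates, in which the segment
   joining [(a, b, c)] to [(x, y, z)] can come closer than 3 to the origin in its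
   half next to [(a, b, c)], a vector of norm 5, when the sum and the difference
   of the two vectors have the same norm. *)
Definition exceptional (a b c x y z : int) :=
  [/\ `|a| = 2 /\ 3 <= `|x|, `|a + x| < `|a| + `|x|, `|b| + `|c| = 3,
      `|y| + `|z| = 2 & `|b + y| = `|b| + `|y| /\ `|c + z| = `|c| + `|z|].

Lemma norm3_parity (x y z k : int) : x + y + z = 1 + 2 * k ->
  exists k, `|x| + `|y| + `|z| = 1 + 2 * k.
Proof.
move=> h; exists (k - Num.min x 0 - Num.min y 0 - Num.min z 0).
have E (t : int) : `|t| = t - 2 * Num.min t 0 by lia.
by rewrite !E; lia.
Qed.

(** Only the first coordinate can change sign on the segment from [(a, b, c)] to
    [(a + x, b + y, c + z)], so the other two contribute linearly. As sum and difference have equal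
    norms, this norm is the sum of the coordinatewise maxima of the absolute values. *)
Lemma both_odd_near1 (a b c x y z m n : int) : 0 <= n -> n <= m ->
  norm3 a b c = 5 -> 5 <= norm3 x y z -> (exists k, x + y + z = 1 + 2 * k) ->
  norm3 (a + x) (b + y) (c + z) = norm3 (a - x) (b - y) (c - z) ->
  (`|b + y| = `|b| + `|y| \/ `|y| <= `|b|) ->
  (`|c + z| = `|c| + `|z| \/ `|z| <= `|c|) ->
  ~ exceptional a b c x y z ->
  3 * (m + n) <= norm3 (m * a + n * x) (m * b + n * y) (m * c + n * z).
Proof.
move=> n0 nm; rewrite /norm3 /exceptional => Na Nx [k /norm3_parity odd] E hb hc nexc.
rewrite (norm_linear n0 nm hb) (norm_linear n0 nm hc).
have mn0 : 0 <= m - n by rewrite subr_ge0.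
have lin := @norm_linear a x m n n0 nm.
have opp := @norm_opposite a x m n n0 nm.
move: (norm_addsub a x) (norm_addsub b y) (norm_addsub c z).
move: Na Nx E hb hc nexc odd lin opp.
move: (normr_ge0 a) (normr_ge0 b) (normr_ge0 c) (normr_ge0 x) (normr_ge0 y) (normr_ge0 z).
move: (`|m * a + n * x|) => V.
move: (`|a|) (`|b|) (`|c|) (`|x|) (`|y|) (`|z|) => A B C X Y Z.
move: (`|a + x|) (`|b + y|) (`|c + z|) (`|a - x|) (`|b - y|) (`|c - z|) => F G H D I J.
clear -n0 nm mn0.
move=> A0 B0 C0 X0 Y0 Z0 Na Nx E hb hc nexc [k odd] lin opp ha hb' hc'.
have [FX|FX] := leP (A + X) F.
  have FX' : F = A + X by lia.
  have : 6 <= F + G + H by clear lin opp nexc; lia.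
  move: Na; rewrite lin; last by left.
  move=> /(congr1 ( *%R (m - n))) P /(ler_wpM2l n0).
  clear -P n0 nm; lia.
have [XA|XA] := leP X A.
  have : 6 <= F + G + H by clear lin opp nexc; lia.
  move: Na; rewrite lin; last by right.
  move=> /(congr1 ( *%R (m - n))) P /(ler_wpM2l n0).
  clear -P n0 nm; lia.
rewrite opp //; clear lin opp.
(* The equality of norms forces [A <= B + C], and [A + B + C = 5]. *)
have [a1|a2] : A = 1 \/ A = 2 by clear nexc; lia.
- have : 5 <= G + H by clear nexc; lia.
  move=> /(ler_wpM2l n0).
  have : 2 <= X by lia.
  move=> /(ler_wpM2l n0).
  have : B + C = 4 by lia.
  move=> /(congr1 ( *%R (m - n))); rewrite a1.
  clear -n0 nm; lia.
have bc : B + C = 3 by lia.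
(* If [G + H] is at most 5, then [Y <= B] and [Z <= C], and what remains is the exceptional
   configuration. *)
have hyz : 6 <= G + H.
  rewrite leNgt; apply/negP => GH; apply: nexc; split; lia.
move: hyz => /(ler_wpM2l n0).
move: bc => /(congr1 ( *%R (m - n))); rewrite a2.
clear -n0 nm; lia.
Qed.

(** With two sign changes, the equality of norms gives [|a| + |b| <= |c|], which leaves only
    [|a| = |b| = 1] and [|c| = 3]. *)
Lemma both_odd_near2 (a b c x y z m n : int) : 0 <= n -> n <= m ->
  norm3 a b c = 5 -> (exists k, x + y + z = 1 + 2 * k) ->
  norm3 (a + x) (b + y) (c + z) = norm3 (a - x) (b - y) (c - z) ->
  `|a + x| < `|a| + `|x| -> `|a| < `|x| ->
  `|b + y| < `|b| + `|y| -> `|b| < `|y| ->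
  3 * (m + n) <= norm3 (m * a + n * x) (m * b + n * y) (m * c + n * z).
Proof.
move=> n0 nm; rewrite /norm3 => Na [k /norm3_parity odd] E ax xa bx yb.
have lin := @norm_linear c z m n n0 nm.
rewrite (norm_opposite n0 nm ax) (norm_opposite n0 nm bx).
move: Na E ax bx xa yb odd lin (norm_addsub a x) (norm_addsub b y) (norm_addsub c z).
move: (normr_ge0 a) (normr_ge0 b) (normr_ge0 c) (normr_ge0 x) (normr_ge0 y) (normr_ge0 z).
move: (`|m * c + n * z|) => V.
move: (`|a|) (`|b|) (`|c|) (`|x|) (`|y|) (`|z|) => A B C X Y Z.
move: (`|a + x|) (`|b + y|) (`|c + z|) (`|a - x|) (`|b - y|) (`|c - z|) => F G H D I J.
clear -n0 nm.
move=> A0 B0 C0 X0 Y0 Z0 Na E ax bx xa yb [k odd] lin ha hb hc.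
have cz : H = C + Z by clear lin; lia.
rewrite lin; last by left.
clear lin.
have [a1 b1] : A = 1 /\ B = 1 by lia.
have c3 : C = 3 by lia.
have z2 : 2 <= Z by lia.
(* If [Z = 2], parity separates [X] from [Y], and the two coordinates that change sign contribute at
   least [n] together. *)
have [z3|xy] : 3 <= Z \/ X + 1 <= Y \/ Y + 1 <= X by lia.
  have := ler_wpM2l n0 z3; rewrite a1 b1 c3 cz c3; clear -n0 nm; lia.
have := ler_wpM2l n0 z2; rewrite a1 b1 c3 cz c3.
case: xy => /(ler_wpM2l n0); clear -n0 nm; lia.
Qed.

Definition exceptional_perm (a b c x y z : int) :=
  [\/ exceptional a b c x y z, exceptional b a c y x z
    | exceptional c a b z x y].

Lemma norm_dichotomy (a x : int) :
  (`|a + x| = `|a| + `|x| \/ `|x| <= `|a|) \/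
  (`|a + x| < `|a| + `|x| /\ `|a| < `|x|).
Proof. by lia. Qed.

Lemma both_odd_near_eq (a b c x y z m n : int) : 0 <= n -> n <= m ->
  norm3 a b c = 5 -> 5 <= norm3 x y z -> (exists k, x + y + z = 1 + 2 * k) ->
  norm3 (a + x) (b + y) (c + z) = norm3 (a - x) (b - y) (c - z) ->
  ~ exceptional_perm a b c x y z ->
  3 * (m + n) <= norm3 (m * a + n * x) (m * b + n * y) (m * c + n * z).
Proof.
move=> n0 nm Na Nx odd E nexc.
have s12 (s t r : int) : norm3 s t r = norm3 t s r by rewrite /norm3; lia.
have s13 (s t r : int) : norm3 s t r = norm3 r s t by rewrite /norm3; lia.
have s31 (s t r : int) : norm3 s t r = norm3 t r s by rewrite /norm3; lia.
have [e1 [e2 e3]] : ~ exceptional a b c x y z /\ ~ exceptional b a c y x z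
  /\ ~ exceptional c a b z x y.
  by split; [|split] => h; apply: nexc; [apply: Or31|apply: Or32|apply: Or33].
have N1 := @both_odd_near1 a b c x y z m n n0 nm Na Nx odd E.
have N2 := @both_odd_near1 b a c y x z m n n0 nm.
rewrite -(s12 a) -(s12 x) -(s12 (a + x)) -(s12 (a - x)) -(s12 (m * a + n * x)) in N2.
have N3 := @both_odd_near1 c a b z x y m n n0 nm.
rewrite -(s13 a) -(s13 x) -(s13 (a + x)) -(s13 (a - x)) -(s13 (m * a + n * x)) in N3.
have P12 := @both_odd_near2 a b c x y z m n n0 nm Na odd E.
have P13 := @both_odd_near2 c a b z x y m n n0 nm.
rewrite -(s13 a) -(s13 (a + x)) -(s13 (a - x)) -(s13 (m * a + n * x)) in P13.
have P23 := @both_odd_near2 b c a y z x m n n0 nm.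
rewrite -(s31 a) -(s31 (a + x)) -(s31 (a - x)) -(s31 (m * a + n * x)) in P23.
have odd2 : exists k, y + x + z = 1 + 2 * k by case: odd => k h; exists k; lia.
have odd3 : exists k, z + x + y = 1 + 2 * k by case: odd => k h; exists k; lia.
have odd1 : exists k, y + z + x = 1 + 2 * k by case: odd => k h; exists k; lia.
have [ha|[ha ha']] := norm_dichotomy a x.
  have [hb|[hb hb']] := norm_dichotomy b y; first exact: N3.
  by have [hc|[hc hc']] := norm_dichotomy c z; [exact: N2|exact: P23].
have [hb|[hb hb']] := norm_dichotomy b y; last exact: P12.
by have [hc|[hc hc']] := norm_dichotomy c z; [exact: N1|exact: P13].
Qed.

(** A convexity estimate suffices as soon as twice the norm of the first vector plus the excess of
    the sum over the difference reaches 12. By parity this fails only for norm 5 and excess 0. *)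
Lemma both_odd_near (a b c x y z m n : int) : 0 <= n -> n <= m ->
  5 <= norm3 a b c -> 5 <= norm3 x y z ->
  (exists k, a + b + c = 1 + 2 * k) -> (exists k, x + y + z = 1 + 2 * k) ->
  norm3 (a - x) (b - y) (c - z) <= norm3 (a + x) (b + y) (c + z) ->
  (norm3 (a + x) (b + y) (c + z) = norm3 (a - x) (b - y) (c - z) ->
  ~ exceptional_perm a b c x y z) ->
  3 * (m + n) <= norm3 (m * a + n * x) (m * b + n * y) (m * c + n * z).
Proof.
move=> n0 nm Na Nx oa ox D nexc.
have [[Na5 E]|] : norm3 a b c = 5 /\
  norm3 (a + x) (b + y) (c + z) = norm3 (a - x) (b - y) (c - z)
  \/ 12 <= 2 * norm3 a b c + (norm3 (a + x) (b + y) (c + z) - norm3 (a - x) (b - y) (c - z)).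
- have [p pE] : exists p, norm3 (a + x) (b + y) (c + z) - norm3 (a - x) (b - y) (c - z) = 2 * p.
    exists (Num.min (a - x) 0 - Num.min (a + x) 0 + Num.min (b - y) 0 - Num.min (b + y) 0
      + Num.min (c - z) 0 - Num.min (c + z) 0 + x + y + z).
    have E (t : int) : `|t| = t - 2 * Num.min t 0 by lia.
    by rewrite /norm3 !E; lia.
  have [k' [k h']] : exists k' k, norm3 a b c = 1 + 2 * k /\ k' = k.
    by case: oa => k /norm3_parity[k' ?]; exists k', k'.
  by move: Na D h' pE; move: (norm3 a b c) (norm3 (a - x) _ _) (norm3 (a + x) _ _) => *; lia.
- exact: both_odd_near_eq (nexc E).
(* The arguments are chosen so that [(m + n) * (2 * s) - 2 * n * (s - t)] is
   [2 * (m * s + n * t)]. *)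
have q (s t : int) := @norm_near (2 * s) (s - t) (m + n) (2 * n).
have n0' : 0 <= 2 * n by lia.
have nm' : 2 * n <= m + n by lia.
move=> /(ler_wpM2l (addr_ge0 (le_trans n0 nm) n0)).
have := q a x n0' nm'; have := q b y n0' nm'; have := q c z n0' nm'.
have e2 (s : int) : `|2 * s| = 2 * `|s| by lia.
have e (s t : int) : `|(m + n) * (2 * s) - 2 * n * (s - t)| = 2 * `|m * s + n * t|
  by rewrite -e2; congr (`|_|); lia.
have e3 (s t : int) : 2 * s - (s - t) = s + t by lia.
rewrite /norm3 !e !e2 !e3.
move: (`|a|) (`|b|) (`|c|) (`|x|) (`|y|) (`|z|) => A B C X Y Z.
move: (`|a + x|) (`|b + y|) (`|c + z|) (`|a - x|) (`|b - y|) (`|c - z|) => F G H D' I J.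
move: (`|m * a + n * x|) (`|m * b + n * y|) (`|m * c + n * z|).
clear; lia.
Qed.

(* The relations [3 a + 2 b = 0], [2 a - 3 b = 0] of [C_13(1, 5)], up to signs. *)
Definition twisted_pair (a b c x y z : int) :=
  [/\ `|c| = 0 /\ `|z| = 0, `|a| = 3 /\ `|x| = 2, `|b| = 2 /\ `|y| = 3
    & (`|a + x| = 5 /\ `|b + y| = 1) \/ (`|a + x| = 1 /\ `|b + y| = 5)].

Definition twisted_pair_perm (a b c x y z : int) :=
  [\/ twisted_pair a b c x y z \/ twisted_pair b a c y x z,
      twisted_pair a c b x z y \/ twisted_pair c a b z x y
    | twisted_pair b c a y z x \/ twisted_pair c b a z y x].

(** The two hypotheses concern the two sign choices for the second vector, near the first vector and
    near the second one. Comparing the special coordinates leaves only the relations of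
    [C_13(1, 5)]. *)
Lemma exceptional_twisted (a b c x y z : int) :
  exceptional_perm a b c x y z ->
  exceptional_perm (- x) (- y) (- z) a b c ->
  twisted_pair_perm a b c x y z.
Proof.
rewrite /exceptional_perm /exceptional !normrN.
have o (s t : int) : - s + t = t - s by rewrite addrC.
rewrite !o /twisted_pair_perm /twisted_pair.
move: (norm_addsub a x) (norm_addsub b y) (norm_addsub c z).
move: (normr_ge0 a) (normr_ge0 b) (normr_ge0 c) (normr_ge0 x) (normr_ge0 y) (normr_ge0 z).
move: (`|a|) (`|b|) (`|c|) (`|x|) (`|y|) (`|z|) => A B C X Y Z.
move: (`|a + x|) (`|b + y|) (`|c + z|) (`|a - x|) (`|b - y|) (`|c - z|) => F G H D' I J.
clear=> ? ? ? ? ? ? NA NB NC.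
case=> -[[? ?] ? ? ? [? ?]]; case=> -[[? ?] ? ? ? [? ?]]; try (exfalso;
  clear NA NB NC; lia).
- by apply: Or31; right; split; lia.
- by apply: Or32; right; split; lia.
- by apply: Or31; left; split; lia.
- by apply: Or33; right; split; lia.
- by apply: Or32; left; split; lia.
- by apply: Or33; left; split; lia.
Qed.

(** The special coordinate cannot be the same for both signs, and it cannot differ either, since
    only one coordinate of [(x, y, z)] can reach 3 in absolute value. *)
Lemma exceptional_opp (a b c x y z : int) :
  exceptional_perm a b c x y z -> exceptional_perm a b c (- x) (- y) (- z) ->
  False.
Proof.
rewrite /exceptional_perm /exceptional !normrN.
have NA (s t : int) : `|s + t| < `|s| + `|t| -> `|s - t| < `|s| + `|t| -> False.
  by case: (norm_addsub s t) => -[-> ->]; rewrite ltxx.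
move: (NA a x) (NA b y) (NA c z) => {NA}.
move: (normr_ge0 a) (normr_ge0 b) (normr_ge0 c) (normr_ge0 x) (normr_ge0 y) (normr_ge0 z).
move: (`|a|) (`|b|) (`|c|) (`|x|) (`|y|) (`|z|) => A B C X Y Z.
move: (`|a + x|) (`|b + y|) (`|c + z|) (`|a - x|) (`|b - y|) (`|c - z|) => F G H D' I J.
clear=> ? ? ? ? ? ? NA NB NC.
by case=> -[[? ?] fx ? ? [? ?]]; case=> -[[? ?] fy ? ? [? ?]];
  first [exact: NA|exact: NB|exact: NC|clear NA NB NC; lia].
Qed.

Lemma exceptional_oppl (a b c x y z : int) :
  exceptional_perm (- a) (- b) (- c) x y z ->
  exceptional_perm a b c (- x) (- y) (- z).
Proof.
have e (s t : int) : `|- s + t| = `|s - t| by rewrite -normrN opprD opprK.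
by rewrite /exceptional_perm /exceptional !normrN !e.
Qed.

Lemma twisted_pair_permC (a b c x y z : int) :
  twisted_pair_perm a b c x y z -> twisted_pair_perm x y z a b c.
Proof.
have C (s t r u v w : int) : twisted_pair s t r u v w -> twisted_pair v u w t s r.
  by rewrite /twisted_pair !(addrC u) !(addrC v) => -[[? ?] [? ?] [? ?] h];
    split => //; case: h => -[? ?]; [right|left].
case=> -[] h; [apply: Or31; right|apply: Or31; left|apply: Or32; right
  |apply: Or32; left|apply: Or33; right|apply: Or33; left]; exact: C h.
Qed.

(** For [m] and [n] of opposite signs, [|m + n|] is at most the larger of [|m|] and [|n|], so
    [odd_vector_aux] suffices. *)
Lemma functional_both_odd (a b c x y z : int) :
  5 <= norm3 a b c -> 5 <= norm3 x y z ->
  (exists k, a + b + c = 1 + 2 * k) -> (exists k, x + y + z = 1 + 2 * k) ->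
  norm3 x y z <= norm3 (a - x) (b - y) (c - z) ->
  norm3 a b c <= norm3 (a - x) (b - y) (c - z) ->
  (forall m n, 0 <= m -> 0 <= n -> 3 * (m + n) <=
    norm3 (m * a + n * x) (m * b + n * y) (m * c + n * z)) ->
  functional a b c x y z 1 1.
Proof.
move=> Na Nx oa ox H1 H2 seg; split.
- by [].
- by [].
have neg (s t r : int) : norm3 (- s) (- t) (- r) =
  norm3 s t r by rewrite /norm3 !normrN.
have H3 : norm3 (a - x) (b - y) (c - z) = norm3 (x - a) (y - b) (z - c).
  by rewrite -neg !opprB.
have P m n (m0 : 0 <= m) (n0 : 0 <= n) := odd_vector_aux m0 n0 H1 H2 Na oa.
have P' m n (m0 : 0 <= m) (n0 : 0 <= n) :
  3 * n <= norm3 (m * a - n * x) (m * b - n * y) (m * c - n * z).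
  rewrite -neg !opprB; apply: odd_vector_aux => //; rewrite -H3 //.
move=> m n; rewrite !mulr1.
case: (lerP 0 m) => hm; case: (lerP 0 n) => hn.
- by rewrite ger0_norm ?addr_ge0 //; apply: seg.
- have hn' : 0 <= - n by rewrite oppr_ge0 ltW.
  have := P _ _ hm hn'; have := P' _ _ hm hn'; rewrite !mulNr !opprK.
  move: (norm3 _ _ _); clear -hm hn; lia.
- have hm' : 0 <= - m by rewrite oppr_ge0 ltW.
  have := P _ _ hm' hn; have := P' _ _ hm' hn; rewrite -neg !mulNr !opprB !opprK.
  rewrite !(addrC (n * _)).
  move: (norm3 _ _ _); clear -hm hn; lia.
- have hm' : 0 <= - m by rewrite oppr_ge0 ltW.
  have hn' : 0 <= - n by rewrite oppr_ge0 ltW.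
  have := seg _ _ hm' hn'; rewrite -neg !mulNr -!opprD !opprK.
  move: (norm3 _ _ _) hm hn; clear; lia.
Qed.

Definition good_pair (a b c x y z : int) := exists p q, functional a b c x y z p q.

Lemma good_or_twisted_aux (a b c x y z : int) :
  5 <= norm3 a b c -> 5 <= norm3 x y z ->
  (exists k, a + b + c = 1 + 2 * k) -> (exists k, x + y + z = 1 + 2 * k) ->
  norm3 x y z <= norm3 (a - x) (b - y) (c - z) ->
  norm3 a b c <= norm3 (a - x) (b - y) (c - z) ->
  norm3 (a - x) (b - y) (c - z) <= norm3 (a + x) (b + y) (c + z) ->
  (norm3 (a + x) (b + y) (c + z) = norm3 (a - x) (b - y) (c - z) ->
   ~ exceptional_perm a b c x y z /\ ~ exceptional_perm x y z a b c) ->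
  functional a b c x y z 1 1.
Proof.
move=> Na Nx oa ox H1 H2 H3 nexc; apply: functional_both_odd => // m n m0 n0.
have neg (s t r : int) : norm3 (- s) (- t) (- r) =
  norm3 s t r by rewrite /norm3 !normrN.
have [nm|/ltW mn] := leP n m.
  by apply: both_odd_near => // /nexc[].
rewrite (addrC m) (addrC (m * a)) (addrC (m * b)) (addrC (m * c)).
have E : norm3 (x - a) (y - b) (z - c) = norm3 (a - x) (b - y) (c - z).
  by rewrite -neg !opprB.
apply: both_odd_near; rewrite ?E ?(addrC x) ?(addrC y) ?(addrC z) //.
by case/nexc.
Qed.

Lemma functional_oppr (a b c x y z p q : int) :
  functional a b c (- x) (- y) (- z) p q -> functional a b c x y z p (- q).
Proof.
case=> h1 [k h2] h3; split=> //; first by exists (- k); lia.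
by move=> m n; have := h3 m (- n); rewrite !mulrN !mulNr !opprK.
Qed.

(** The choice is [q = 1] when the difference is shorter than the sum and [q = - 1] when it is
    longer. In a tie either sign works, unless both are obstructed. *)
Lemma good_or_twisted (a b c x y z : int) :
  5 <= norm3 a b c -> 5 <= norm3 x y z ->
  (exists k, a + b + c = 1 + 2 * k) -> (exists k, x + y + z = 1 + 2 * k) ->
  norm3 x y z <= norm3 (a - x) (b - y) (c - z) ->
  norm3 a b c <= norm3 (a - x) (b - y) (c - z) ->
  norm3 x y z <= norm3 (a + x) (b + y) (c + z) ->
  norm3 a b c <= norm3 (a + x) (b + y) (c + z) ->
  good_pair a b c x y z \/ twisted_pair_perm a b c x y z.
Proof.
move=> Na Nx oa ox H1 H2 H3 H4.
have oNx : exists k, - x - y - z = 1 + 2 * k.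
  by case: ox => k h; exists (- k - 1); lia.
have NNx : norm3 (- x) (- y) (- z) = norm3 x y z by rewrite /norm3 !normrN.
have P : (norm3 (a + x) (b + y) (c + z) < norm3 (a - x) (b - y) (c - z) \/
  (norm3 (a + x) (b + y) (c + z) = norm3 (a - x) (b - y) (c - z) /\
   (~ exceptional_perm a b c (- x) (- y) (- z) /\
    ~ exceptional_perm (- x) (- y) (- z) a b c))) -> good_pair a b c x y z.
  move=> h; exists 1, (- 1); apply: functional_oppr; apply: good_or_twisted_aux;
    rewrite ?NNx ?opprK //; first by case: h => [/ltW|[-> _]].
  by case: h => [/lt_eqF/eqP h /esym|[_ h] _].
have P' : (norm3 (a - x) (b - y) (c - z) < norm3 (a + x) (b + y) (c + z) \/
  (norm3 (a + x) (b + y) (c + z) = norm3 (a - x) (b - y) (c - z) /\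
   (~ exceptional_perm a b c x y z /\ ~ exceptional_perm x y z a b c))) ->
   good_pair a b c x y z.
  move=> h; exists 1, 1; apply: good_or_twisted_aux => //;
    first by case: h => [/ltW|[-> _]].
  by case: h => [/lt_eqF/eqP h /esym|[_ h] _].
case: (ltgtP (norm3 (a + x) (b + y) (c + z)) (norm3 (a - x) (b - y) (c - z))) => E.
- by left; apply: P; left.
- by left; apply: P'; left.
(* Each sign has two possible obstructions: [e1], [e2] for one and [e3], [e4] for the other. The
   pairs [e1], [e3] and [e2], [e4] are contradictory, while [e1], [e4] and [e2], [e3] give twisted
   pairs. *)
have [e1|n1] := pselect (exceptional_perm a b c x y z);
have [e2|n2] := pselect (exceptional_perm x y z a b c);
have [e3|n3] := pselect (exceptional_perm a b c (- x) (- y) (- z));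
have [e4|n4] := pselect (exceptional_perm (- x) (- y) (- z) a b c);
 try (by case: (exceptional_opp e1 e3)); try (by right;
   exact: exceptional_twisted e1 e4);
 try (by left; apply: P'; right); try (by left; apply: P; right).
- by case: (exceptional_opp e2 (exceptional_oppl e4)).
- right; apply: twisted_pair_permC; apply: exceptional_twisted e2 _.
  by have := @exceptional_oppl (- a) (- b) (- c) (- x) (- y) (- z);
    rewrite !opprK; apply.
- by case: (exceptional_opp e2 (exceptional_oppl e4)).
Qed.

(** * Short vectors, axis vectors and the cases for a reduced basis *)

Definition short_vector (a b c : int) :=
  norm3 a b c = 1 \/ [/\ norm3 a b c = 3, `|a| <= 2, `|b| <= 2 & `|c| <= 2].

Lemma functional_swap (a b c x y z p q : int) :
  functional a b c x y z p q -> functional x y z a b c q p.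
Proof.
case=> h1 h2 h3; split=> // m n; have := h3 n m.
by rewrite (addrC (n * p)) (addrC (n * a)) (addrC (n * b)) (addrC (n * c)).
Qed.

Lemma parity_cases (s : int) : (exists k, s = 0 + 2 * k) \/ (exists k, s = 1 + 2 * k).
Proof.
have : (s %% 2)%Z = 0 \/ (s %% 2)%Z = 1 by lia.
by case=> h; [left|right]; exists (s %/ 2)%Z; lia.
Qed.

(** Reducedness against an axis vector of norm 3 forces [|t| <= 1]. If [|t| = 1], one of [|s - t|]
    and [|s + t|] is 2, hence [u + v >= 1]. *)
Lemma axis_main (s t u v : int) (m n : int) : `|s| = 3 ->
   `|t| <= `|s - t| -> `|t| <= `|s + t| ->
   3 <= `|s - t| + u + v -> 3 <= `|s + t| + u + v -> 0 <= u -> 0 <= v ->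
   3 * `|m| <= `|m * s + n * t| + (`|n| * u + `|n| * v).
Proof.
  move=> s3 h1 h2 h3 h4 u0 v0.
  have t1 : `|t| <= 1 by clear h3 h4; lia.
  rewrite -mulrDr.
  have [t0|[t1' uv]] : t = 0 \/ (`|t| = 1 /\ 1 <= u + v) by lia.
    have := mulr_ge0 (normr_ge0 n) (addr_ge0 u0 v0).
    rewrite t0 mulr0 addr0 normrM s3.
  move: (_ * (u + v)); clear; lia.
  have := ler_wpM2l (normr_ge0 n) uv; move: (_ * (u + v)).
  have [-> | ->] : s = 3 \/ s = - 3 by clear -s3; lia.
  all: have [-> | ->] : t = 1 \/ t = - 1 by clear -t1'; lia.
  all: clear; lia.
Qed.

Lemma functional_axis (a b c x y z : int) : norm3 a b c = 3 ->
  (`|a| = 3 \/ `|b| = 3 \/ `|c| = 3) ->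
  (exists k, x + y + z = 0 + 2 * k) ->
  norm3 x y z <= norm3 (a - x) (b - y) (c - z) ->
  norm3 a b c <= norm3 (a - x) (b - y) (c - z) ->
  norm3 x y z <= norm3 (a + x) (b + y) (c + z) ->
  norm3 a b c <= norm3 (a + x) (b + y) (c + z) ->
  functional a b c x y z 1 0.
Proof.
rewrite /norm3 => N A ex H1 H2 H3 H4.

split; [|done|move=> m n].
  have [k h] : exists k, a + b + c = 1 + 2 * k.
    by exists ((a + b + c - 1) %/ 2)%Z; clear -N; lia.
  by exists k.
rewrite /norm3 mulr1 mulr0 addr0.
case: A => [A|[A|A]].
- have [b0 c0] : b = 0 /\ c = 0 by clear -A N; lia.
  have := @axis_main a x `|y| `|z| m n A.
  rewrite b0 c0 !mulr0 !add0r (normrM n y) (normrM n z) => P.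
  suff : 3 * `|m| <= `|m * a + n * x| + (`|n| * `|y| + `|n| * `|z|).
    by move=> h; apply: (le_trans h); clear;
      move: (`|m * _ + n * _|) (`|n| * _) (`|n| * _); lia.
  apply: P; [clear -H1 b0 c0|clear -H3 b0 c0|clear -H2 N A b0 c0|clear -H4 N A b0 c0|clear|clear]; lia.
- have [b0 c0] : a = 0 /\ c = 0 by clear -A N; lia.
  have := @axis_main b y `|x| `|z| m n A.
  rewrite b0 c0 !mulr0 !add0r (normrM n x) (normrM n z) => P.
  suff : 3 * `|m| <= `|m * b + n * y| + (`|n| * `|x| + `|n| * `|z|).
    by move=> h; apply: (le_trans h); clear;
      move: (`|m * _ + n * _|) (`|n| * _) (`|n| * _); lia.
  apply: P; [clear -H1 b0 c0|clear -H3 b0 c0|clear -H2 N A b0 c0|clear -H4 N A b0 c0|clear|clear]; lia.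
- have [b0 c0] : a = 0 /\ b = 0 by clear -A N; lia.
  have := @axis_main c z `|x| `|y| m n A.
  rewrite b0 c0 !mulr0 !add0r (normrM n x) (normrM n y) => P.
  suff : 3 * `|m| <= `|m * c + n * z| + (`|n| * `|x| + `|n| * `|y|).
    by move=> h; apply: (le_trans h); clear;
      move: (`|m * _ + n * _|) (`|n| * _) (`|n| * _); lia.
  apply: P; [clear -H1 b0 c0|clear -H3 b0 c0|clear -H2 N A b0 c0|clear -H4 N A b0 c0|clear|clear]; lia.
Qed.

(** Again [|t| <= 1], and the size hypothesis gives [u + v >= |t| + 3]. The triangle inequality for
    [m * s] and [m + n] does the rest. *)
Lemma axis_main_odd (s t u v : int) (m n : int) : `|s| = 3 ->
   5 <= `|t| + u + v \/ (`|t| = 3 \/ u = 3 \/ v = 3) /\ `|t| + u + v = 3 ->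
   `|t| <= `|s - t| -> `|t| <= `|s + t| ->
   3 <= `|s - t| + u + v -> 3 <= `|s + t| + u + v -> 0 <= u -> 0 <= v ->
   3 * `|m + n| <= `|m * s + n * t| + (`|n| * u + `|n| * v).
Proof.
  move=> s3 big h1 h2 h3 h4 u0 v0.
  have t1 : `|t| <= 1 by clear big h3 h4; lia.
  have uv : `|t| + 3 <= u + v by case: big => [|[[|[]]]]; clear -t1 s3 u0 v0 h3 h4; lia.
  rewrite -mulrDr; have := ler_wpM2l (normr_ge0 n) uv; move: (_ * (u + v)) => w.
  have := ler_normD (m * s + n * t) (- (n * t)); have := ler_normD m n.
  rewrite addrK normrN !normrM s3; move: (`|m * s + n * t|) (`|m + n|).
  clear; lia.
Qed.

Lemma functional_axis_odd (a b c x y z : int) : norm3 a b c = 3 ->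
  (`|a| = 3 \/ `|b| = 3 \/ `|c| = 3) ->
  (exists k, x + y + z = 1 + 2 * k) ->
  5 <= norm3 x y z \/ (`|x| = 3 \/ `|y| = 3 \/ `|z| = 3) /\ norm3 x y z = 3 ->
  norm3 x y z <= norm3 (a - x) (b - y) (c - z) ->
  norm3 a b c <= norm3 (a - x) (b - y) (c - z) ->
  norm3 x y z <= norm3 (a + x) (b + y) (c + z) ->
  norm3 a b c <= norm3 (a + x) (b + y) (c + z) ->
  functional a b c x y z 1 1.
Proof.
rewrite /norm3 => N A ex big H1 H2 H3 H4.

split; [|done|move=> m n].
  have [k h] : exists k, a + b + c = 1 + 2 * k.
    by exists ((a + b + c - 1) %/ 2)%Z; clear -N; lia.
  by exists k.
rewrite /norm3 !mulr1.
case: A => [A|[A|A]].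
- have [b0 c0] : b = 0 /\ c = 0 by clear -A N; lia.
  have := @axis_main_odd a x `|y| `|z| m n A.
  rewrite b0 c0 !mulr0 !add0r (normrM n y) (normrM n z) => P.
  suff : 3 * `|m + n| <= `|m * a + n * x| + (`|n| * `|y| + `|n| * `|z|).
    by move=> h; apply: (le_trans h); clear;
      move: (`|m * _ + n * _|) (`|n| * _) (`|n| * _); lia.
  apply: P; [clear -big N A b0 c0|clear -H1 b0 c0|clear -H3 b0 c0|clear -H2 N A b0 c0|clear -H4 N A b0 c0|clear|clear]; lia.
- have [b0 c0] : a = 0 /\ c = 0 by clear -A N; lia.
  have := @axis_main_odd b y `|x| `|z| m n A.
  rewrite b0 c0 !mulr0 !add0r (normrM n x) (normrM n z) => P.
  suff : 3 * `|m + n| <= `|m * b + n * y| + (`|n| * `|x| + `|n| * `|z|).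
    by move=> h; apply: (le_trans h); clear;
      move: (`|m * _ + n * _|) (`|n| * _) (`|n| * _); lia.
  apply: P; [clear -big N A b0 c0|clear -H1 b0 c0|clear -H3 b0 c0|clear -H2 N A b0 c0|clear -H4 N A b0 c0|clear|clear]; lia.
- have [b0 c0] : a = 0 /\ b = 0 by clear -A N; lia.
  have := @axis_main_odd c z `|x| `|y| m n A.
  rewrite b0 c0 !mulr0 !add0r (normrM n x) (normrM n y) => P.
  suff : 3 * `|m + n| <= `|m * c + n * z| + (`|n| * `|x| + `|n| * `|y|).
    by move=> h; apply: (le_trans h); clear;
      move: (`|m * _ + n * _|) (`|n| * _) (`|n| * _); lia.
  apply: P; [clear -big N A b0 c0|clear -H1 b0 c0|clear -H3 b0 c0|clear -H2 N A b0 c0|clear -H4 N A b0 c0|clear|clear]; lia.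
Qed.

(** The functional is 0 on even basis vectors and 3 or -3 on odd ones. An odd vector has norm 1, 3
    or at least 5, and one of norm 3 that is not short lies on an axis. *)
Lemma lattice_cases (a b c x y z : int) :
  norm3 x y z <= norm3 (a - x) (b - y) (c - z) ->
  norm3 a b c <= norm3 (a - x) (b - y) (c - z) ->
  norm3 x y z <= norm3 (a + x) (b + y) (c + z) ->
  norm3 a b c <= norm3 (a + x) (b + y) (c + z) ->
  [\/ good_pair a b c x y z, twisted_pair_perm a b c x y z,
      short_vector a b c | short_vector x y z].
Proof.
have odd_big (s t r : int) : (exists k, s + t + r = 1 + 2 * k) ->
  [\/ short_vector s t r, 5 <= norm3 s t r
    | norm3 s t r = 3 /\ (`|s| = 3 \/ `|t| = 3 \/ `|r| = 3) ].
  move=> [k /norm3_parity [k' h]]; rewrite /short_vector.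
  have [h1|[h1|h1]] : norm3 s t r = 1 \/ norm3 s t r = 3 \/ 5 <= norm3 s t r.
    by rewrite /norm3 h; have := normr_ge0 s; have := normr_ge0 t;
      have := normr_ge0 r; clear -h; lia.
  - by apply: Or31; left.
  - have [h2|[h2|[h2|h2]]] : (`|s| <= 2 /\ `|t| <= 2 /\ `|r| <= 2) \/
      (`|s| = 3 \/ (`|t| = 3 \/ `|r| = 3)).
      by move: h1; rewrite /norm3; clear; lia.
    + by apply: Or31; right; case: h2 => ? [? ?]; split.
    + by apply: Or33; split=> //; left.
    + by apply: Or33; split=> //; right; left.
    + by apply: Or33; split=> //; right; right.
  - exact: Or32.
have C (s t r u v w : int) : norm3 (s - u) (t - v) (r - w) =
  norm3 (u - s) (v - t) (w - r).
  by rewrite /norm3 distrC (distrC t) (distrC r).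
move=> H1 H2 H3 H4.
have [e1|o1] := parity_cases (a + b + c); have [e2|o2] := parity_cases (x + y + z).
- apply: Or41; exists 0, 0; split=> // m n;
    have -> : 3 * `|m * 0 + n * 0| = 0 :> int by rewrite !mulr0.
  by rewrite /norm3 !addr_ge0.
- case: (odd_big _ _ _ o2) => [|h|[h1 h2]]; first exact: Or44.
    apply: Or41; exists 0, 1; apply: functional_swap; split=> // m n.
    rewrite mulr1 mulr0 addr0; apply: odd_vector;
      rewrite // 1?C ?(addrC x) ?(addrC y) ?(addrC z) //.
  apply: Or41; exists 0, 1; apply: functional_swap;
    apply: functional_axis => //; rewrite // 1?C ?(addrC x) ?(addrC y) ?(addrC z) //.
- case: (odd_big _ _ _ o1) => [|h|[h1 h2]]; first exact: Or43.
    apply: Or41; exists 1, 0; split=> // m n.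
    by rewrite mulr1 mulr0 addr0; apply: odd_vector.
  by apply: Or41; exists 1, 0; apply: functional_axis.
case: (odd_big _ _ _ o1) => [|h|[h1 h2]]; first exact: Or43.
  case: (odd_big _ _ _ o2) => [|h'|[h1' h2']]; first exact: Or44.
    by have [?|?] := good_or_twisted h h' o1 o2 H1 H2 H3 H4; [apply: Or41|apply: Or42].
  apply: Or41; exists 1, 1; apply: functional_swap.
  apply: functional_axis_odd => //; rewrite // 1?C ?(addrC x) ?(addrC y) ?(addrC z) //.
  by left.
by case: (odd_big _ _ _ o2) => [|h'|[h1' h2']]; [exact: Or44|apply: Or41;
  exists 1, 1; apply: functional_axis_odd; auto|apply: Or41; exists 1, 1;
  apply: functional_axis_odd; auto].
Qed.

Local Open Scope classical_set_scope.

(** * Presentations and 3-colorings *)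

Section Generators.
Variable G : zmodType.
Implicit Types a b c g : G.

Definition gens a b c : set G :=
  [set g | (g = a \/ g = b \/ g = c) /\ g <> 0].

Definition gens_graph a b c : graph G :=
  cayley_graph (gens a b c).

Definition comb a b c (x y z : int) : G := a *~ x + b *~ y + c *~ z.

Lemma cayley_graph_eq (A B : set G) :
  pm_set A = pm_set B -> cayley_graph A = cayley_graph B.
Proof.
move=> AB; rewrite /cayley_graph.
move: (@cayley_sym G A) (@cayley_vert G A); rewrite AB => s v.
by congr Graph; exact: Prop_irrelevance.
Qed.

Lemma pm_setN (A : set G) g : pm_set A g -> pm_set A (- g).
Proof.
case=> [Ag|[h Ah <-]]; first by right; exists g.
by left; rewrite opprK.
Qed.

Lemma combD a b c x y z x' y' z' :
  comb a b c (x + x') (y + y') (z + z') = comb a b c x y z + comb a b c x' y' z'.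
Proof. by rewrite /comb !mulrzDr (addrACA (a *~ x) (a *~ x')) [LHS]addrACA. Qed.

Lemma combZ a b c x y z m :
  comb a b c (m * x) (m * y) (m * z) = comb a b c x y z *~ m.
Proof. by rewrite /comb !mulrzDl !mulrzA_C. Qed.

Lemma combN a b c x y z : comb a b c (- x) (- y) (- z) = - comb a b c x y z.
Proof. by rewrite /comb !mulrNz !opprD. Qed.

Lemma combB a b c x y z x' y' z' :
  comb a b c (x - x') (y - y') (z - z') = comb a b c x y z - comb a b c x' y' z'.
Proof. by rewrite combD combN. Qed.

(* A trivial generator is dropped: it has no edges in [gens_graph], and the
   corresponding coordinate of the relations is required to vanish. *)
Record presentation a b c (x1 y1 z1 x2 y2 z2 : int) : Prop := Presentation {
  pres_gen : forall g, exists x y z, [/\ g = comb a b c x y z,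
    a = 0 -> x = 0, b = 0 -> y = 0 & c = 0 -> z = 0];
  pres_rel1 : comb a b c x1 y1 z1 = 0;
  pres_rel2 : comb a b c x2 y2 z2 = 0;
  pres_ker : forall x y z, comb a b c x y z = 0 -> exists m n : int,
    [/\ a <> 0 -> x = m * x1 + n * x2, b <> 0 -> y = m * y1 + n * y2
      & c <> 0 -> z = m * z1 + n * z2];
  pres_dead : [/\ a = 0 -> x1 = 0 /\ x2 = 0, b = 0 -> y1 = 0 /\ y2 = 0
    & c = 0 -> z1 = 0 /\ z2 = 0] }.

(** Each group element is colored through one chosen representation, and periodicity makes the
    choice immaterial. Coordinates of trivial generators are kept at 0, because [pres_ker] does not
    control them. *)
Lemma colorable_of_periodic a b c x1 y1 z1 x2 y2 z2 k
    (K : int -> int -> int -> nat) :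
  presentation a b c x1 y1 z1 x2 y2 z2 ->
  (forall x y z, (K x y z < k)%N) ->
  (forall x y z m n, K (x + (m * x1 + n * x2)) (y + (m * y1 + n * y2))
    (z + (m * z1 + n * z2)) = K x y z) ->
  (forall x y z, K (x + 1) y z <> K x y z) ->
  (forall x y z, K x (y + 1) z <> K x y z) ->
  (forall x y z, K x y (z + 1) <> K x y z) ->
  colorable k (gens_graph a b c).
Proof.
move=> [gen _ _ ker [da db dc]] Kk per Ka Kb Kc.
have /choice[r rP] : forall g, exists v : int * int * int,
    [/\ g = comb a b c v.1.1 v.1.2 v.2,
     a = 0 -> v.1.1 = 0, b = 0 -> v.1.2 = 0 & c = 0 -> v.2 = 0].
  by move=> g; have [x [y [z h]]] := gen g; exists (x, y, z).
pose col g := Ordinal (Kk (r g).1.1 (r g).1.2 (r g).2).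
have key g g' (x y z : int) : g' = g + comb a b c x y z ->
    (a = 0 -> x = 0) -> (b = 0 -> y = 0) -> (c = 0 -> z = 0) ->
    col g' = K ((r g).1.1 + x) ((r g).1.2 + y) ((r g).2 + z) :> nat.
  move=> E hx hy hz; rewrite /=.
  case: (rP g) (rP g'); move: (r g) (r g') => [[s t] u] [[s' t'] u'] /=.
  move=> Eg as0 bt0 cu0 [Eg' as0' bt0' cu0'].
  have [m [n [hm hn hk]]] : exists m n : int, [/\ a <> 0 ->
    s' - (s + x) = m * x1 + n * x2,
      b <> 0 -> t' - (t + y) = m * y1 + n * y2
      & c <> 0 -> u' - (u + z) = m * z1 + n * z2].
    by apply: ker; rewrite combB combD -Eg' -Eg E subrr.
  rewrite -[RHS](per _ _ _ m n); congr K.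
  - have [a0|/hm <-] := pselect (a = 0); last by rewrite [RHS]addrC subrK.
    by have [-> ->] := da a0; rewrite as0 // as0' // hx // !mulr0.
  - have [a0|/hn <-] := pselect (b = 0); last by rewrite [RHS]addrC subrK.
    by have [-> ->] := db a0; rewrite bt0 // bt0' // hy // !mulr0.
  - have [a0|/hk <-] := pselect (c = 0); last by rewrite [RHS]addrC subrK.
    by have [-> ->] := dc a0; rewrite cu0 // cu0' // hz // !mulr0.
have step g h : (h = a \/ h = b \/ h = c) /\ h <> 0 -> col (g + h) <> col g.
  case=> hh h0 /(congr1 (@nat_of_ord k)).
  case: hh => [ha|[hb|hc]].
  - rewrite (key g _ 1 0 0) ?addr0 //; first exact: Ka.
      by rewrite ha /comb mulr1z !mulr0z !addr0.
    by rewrite -ha.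
  - rewrite (key g _ 0 1 0) ?addr0 //; first exact: Kb.
      by rewrite hb /comb mulr1z !mulr0z add0r !addr0.
    by rewrite -hb.
  - rewrite (key g _ 0 0 1) ?addr0 //; first exact: Kc.
      by rewrite hc /comb mulr1z !mulr0z !add0r.
    by rewrite -hc.
exists col => g g' [h|[h hh E]].
  by have := step g _ h; rewrite addrC subrK => /nesym.
by have := step g' _ hh; rewrite -[h]opprK E opprB addrC subrK.
Qed.

(** * Integer height functions *)

Lemma int_minimum (P : int -> Prop) (l : int) :
  (exists t, P t) -> (forall t, P t -> l <= t) ->
  exists2 t, P t & forall s, P s -> t <= s.
Proof.
move=> [t Pt] lP.
have ex : exists n : nat, `[< P (l + n%:Z) >].
  exists `|t - l|%N; apply/asboolP.
  by have -> : l + `|t - l|%N%:Z = t by have := lP _ Pt; lia.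
case: (ex_minnP ex) => n /asboolP Pn min; exists (l + n%:Z) => // s Ps.
have : (n <= `|s - l|)%N.
  apply: min; apply/asboolP.
  by have -> : l + `|s - l|%N%:Z = s by have := lP _ Ps; lia.
have := lP _ Ps; lia.
Qed.

Lemma norm3_tri (s t r u v w : int) :
  norm3 (s + u) (t + v) (r + w) <= norm3 s t r + norm3 u v w.
Proof.
rewrite /norm3; have := ler_normD s u; have := ler_normD t v.
have := ler_normD r w.
move: (`|s|) (`|t|) (`|r|) (`|u|) (`|v|) (`|w|) (`|s + u|) (`|t + v|) (`|r + w|).
by clear; lia.
Qed.

Lemma norm3N (s t r : int) : norm3 (- s) (- t) (- r) = norm3 s t r.
Proof. by rewrite /norm3 !normrN. Qed.

Lemma norm3_sum (s t r : int) : exists k, norm3 s t r = s + t + r + 2 * k.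
Proof.
have E (u : int) : `|u| = u - 2 * Num.min u 0 by lia.
exists (- Num.min s 0 - Num.min t 0 - Num.min r 0); rewrite /norm3 !E.
by lia.
Qed.

(* The McShane-type extension of a functional on the relation lattice to an
   integer height function on [Z^3] that changes by 1 along each edge. *)
Lemma height_function (x1 y1 z1 x2 y2 z2 p q : int) :
  functional x1 y1 z1 x2 y2 z2 p q ->
  exists h : int -> int -> int -> int,
  [/\ forall x y z m n, h (x + (m * x1 + n * x2)) (y + (m * y1 + n * y2))
        (z + (m * z1 + n * z2)) = h x y z + 3 * (m * p + n * q),
      forall x y z, exists k, h x y z = x + y + z + 2 * k
    & forall x y z x' y' z',
        h x' y' z' <= h x y z + norm3 (x' - x) (y' - y) (z' - z)].
Proof.
case=> -[k1 e1] [k2 e2] bnd.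
pose val (x y z m n : int) : int := 3 * (m * p + n * q) +
  norm3 (x - (m * x1 + n * x2)) (y - (m * y1 + n * y2)) (z - (m * z1 + n * z2)).
have /choice[h hP] : forall v : int * int * int, exists t : int,
    (exists m n : int, t = val v.1.1 v.1.2 v.2 m n) /\
    forall m n, t <= val v.1.1 v.1.2 v.2 m n.
  move=> [[x y] z] /=.
  (* The bound on the functional and the triangle inequality keep all values at or above
     [- norm3 x y z], so the minimum exists. *)
  case: (@int_minimum (fun t => exists m n : int, t = val x y z m n) (- norm3 x y z)).
  - by exists (val x y z 0 0), 0, 0.
  - move=> t [m [n ->]]; rewrite /val.
    have := bnd m n.
    have := norm3_tri (x - (m * x1 + n * x2)) (y - (m * y1 + n * y2))
      (z - (m * z1 + n * z2)) (- x) (- y) (- z).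
    have e (s u : int) : s - u + - s = - u by ring.
    rewrite !e !norm3N.
    have := ler_norm (- (m * p + n * q)); rewrite normrN.
    move: (norm3 _ _ _) (norm3 (x - _) _ _) (norm3 x y z) => A B C.
    by move: (m * p + n * q) => D; clear; lia.
  - by move=> t Pt tmin; exists t; split=> // m n; apply: tmin; exists m, n.
exists (fun x y z => h (x, y, z)); split.
(* Translating a relation that attains the minimum gives one inequality; the other follows by moving
   back with [- m] and [- n]. *)
- have le x y z m n : h (x + (m * x1 + n * x2), y + (m * y1 + n * y2),
      z + (m * z1 + n * z2)) <= h (x, y, z) + 3 * (m * p + n * q).
    have [[m' [n' ->]] _] := hP (x, y, z) => /=.
    have [_ /(_ (m + m') (n + n')) /=] :=
      hP (x + (m * x1 + n * x2), y + (m * y1 + n * y2),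
      z + (m * z1 + n * z2)).
    move/le_trans; apply.
    have e (s t u : int) : s + (m * t + n * u) - ((m + m') * t + (n + n') * u) = s - (m' * t + n' * u) by ring.
    by rewrite /val !e; move: (norm3 _ _ _) => A; lia.
  move=> x y z m n; apply/le_anti; rewrite le /=.
  have := le (x + (m * x1 + n * x2)) (y + (m * y1 + n * y2)) (z + (m * z1 + n * z2)) (- m) (- n).
  have e (s t u : int) : s + (m * t + n * u) + (- m * t + - n * u) = s by ring.
  rewrite !e; move: (h (x, y, z)) (h (_ + _, _, _)) => A B; clear; lia.
- move=> x y z; have [[m [n ->]] _] := hP (x, y, z); rewrite /val /=.
  have [k ->] := norm3_sum (x - (m * x1 + n * x2)) (y - (m * y1 + n * y2)) (z - (m * z1 + n * z2)).
  exists (k + m * p + n * q - m * k1 - n * k2).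
  have -> : x - (m * x1 + n * x2) + (y - (m * y1 + n * y2)) + (z - (m * z1 + n * z2))
    = x + y + z - m * (x1 + y1 + z1) - n * (x2 + y2 + z2) by ring.
  by rewrite e1 e2; ring.
- move=> x y z x' y' z'.
  have [[m [n ->]] _] := hP (x, y, z).
  have [_ /(_ m n) /le_trans] := hP (x', y', z'); apply; rewrite /val /= -addrA lerD2l.
  have e (s t u v : int) : s - v = (t - v) + (s - t) by ring.
  by rewrite (e x' x) // (e y' y) // (e z' z) // norm3_tri.
Qed.

(** Along an edge the height changes by an odd integer of absolute value at most 1, and along a
    relation by a multiple of 3, so the height modulo 3 is a coloring. *)
Lemma colorable3_of_functional a b c x1 y1 z1 x2 y2 z2 :
  presentation a b c x1 y1 z1 x2 y2 z2 ->
  (exists p q, functional x1 y1 z1 x2 y2 z2 p q) ->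
  colorable 3 (gens_graph a b c).
Proof.
move=> P [p [q /height_function [h [per par lip]]]].
apply: (colorable_of_periodic (K := fun x y z => `|(h x y z %% 3)%Z|%N) P).
- by move=> x y z; lia.
- by move=> x y z m n; rewrite per; lia.
all: move=> x y z.
all: have [k] := par x y z.
- have := lip x y z (x + 1) y z; have := lip (x + 1) y z x y z.
  have [l] := par (x + 1) y z; rewrite /norm3 !subrr.
  by move: (h _ _ _) (h _ _ _) => A B; lia.
- have := lip x y z x (y + 1) z; have := lip x (y + 1) z x y z.
  have [l] := par x (y + 1) z; rewrite /norm3 !subrr.
  by move: (h _ _ _) (h _ _ _) => A B; lia.
- have := lip x y z x y (z + 1); have := lip x y (z + 1) x y z.
  have [l] := par x y (z + 1); rewrite /norm3 !subrr.
  by move: (h _ _ _) (h _ _ _) => A B; lia.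
Qed.

End Generators.

(** * Obstructions to colorings *)

Lemma colorable_copy (V W : Type) k (K : graph V) (X : graph W) :
  contains_copy K X -> colorable k X ->
  exists c : V -> 'I_k, forall x y, adj K x y -> c x <> c y.
Proof.
by case=> f [_ _ fE] [c cP]; exists (c \o f) => x y /fE; apply: cP.
Qed.

Lemma colorable_leq (V : Type) (X : graph V) k l : (k <= l)%N ->
  colorable k X -> colorable l X.
Proof.
move=> kl [c cP]; exists (widen_ord kl \o c) => x y xy /(congr1 val) /= e.
by apply: (cP x y xy); apply: val_inj.
Qed.

Lemma complete_not_colorable (V : Type) (X : graph V) n k : (k < n)%N ->
  contains_copy (complete_graph 'I_n) X -> ~ colorable k X.
Proof.
move=> kn cp /(colorable_copy cp)[c cP].
have inj : injective c.
  by move=> i j cij; apply: contrapT => /cP.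
by have := leq_card c inj; rewrite !card_ord leqNgt kn.
Qed.

Lemma third_color (s t u v : 'I_3) :
  s <> t -> u <> s -> u <> t -> v <> s -> v <> t -> u = v.
Proof.
move=> /eqP st /eqP us /eqP ut /eqP vs /eqP vt; apply/eqP.
have := ltn_ord s; have := ltn_ord t; have := ltn_ord u; have := ltn_ord v.
by move: st us ut vs vt; rewrite -!val_eqE /=; lia.
Qed.

(** If the endpoints had different colors, all other vertices would have the third one. Two such
    vertices are adjacent, so there would be at most three vertices. *)
Lemma diamond_same_color (V : Type) (D : graph V) (E : set V) (c : V -> 'I_3) :
  diamond D E -> (forall x y, adj D x y -> c x <> c y) ->
  forall x y, E x -> E y -> c x = c y.
Proof.
case=> card4 [x [y [Dx Dy xy -> Dadj]]] cP.
suff cxy : c x = c y by move=> u v [] -> [] ->.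
apply: contrapT => ncxy.
have side w : vert D w -> w <> x -> w <> y -> c w <> c x /\ c w <> c y.
  move=> Dw wx wy; split; apply: cP; apply/Dadj => //; split=> // e.
    have : [set w; x] y by rewrite e; right.
    by case=> [/esym|/esym].
  have : [set w; y] x by rewrite e; left.
  by case=> [/esym|].
have uniqw u v : vert D u -> vert D v -> u <> x -> u <> y -> v <> x -> v <> y -> u = v.
  move=> Du Dv ux uy vx vy; apply: contrapT => uv.
  have [us ut] := side u Du ux uy; have [vs vt] := side v Dv vx vy.
  have : adj D u v.
    apply/Dadj => //; split=> // e.
    have : [set x; y] u by rewrite -e; left.
    by case.
  by move/cP; apply; apply: third_color ncxy us ut vs vt.
have /card_bijP[f0 /bij_inj f0I] : (`I_4 #= vert D)%card by rewrite card_eq_sym.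
pose f (i : 'I_4) : V := val (f0 (SigSub (mem_set (ltn_ord i : `I_4 i)))).
(* The three classes are the two endpoints and the rest; [g] would inject four vertices into
   them. *)
pose g (i : 'I_4) : 'I_3 :=
  if `[< f i = x >] then inord 0 else if `[< f i = y >] then inord 1 else inord 2.
have fD (i : 'I_4) : vert D (f i) by exact: set_valP.
have fI (i j : 'I_4) : f i = f j -> i = j.
  by move=> /val_inj/f0I/(congr1 val) /= e; apply: val_inj.
have I3 (u v : nat) : inord u = inord v :> 'I_3 -> (u < 3)%N -> (v < 3)%N -> u = v.
  by move=> /(congr1 val) /=; rewrite /= => + hu hv; rewrite !inordK.
have gI : injective g.
  move=> i j; rewrite /g.
  case: (asboolP (f i = x)) => ix; case: (asboolP (f j = x)) => jx.
  - by move=> _; apply: fI; rewrite ix jx.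
  - by case: asboolP => jy /I3/(_ isT isT).
  - by case: asboolP => iy /I3/(_ isT isT).
  case: (asboolP (f i = y)) => iy; case: (asboolP (f j = y)) => jy.
  - by move=> _; apply: fI; rewrite iy jy.
  - by move=> /I3/(_ isT isT).
  - by move=> /I3/(_ isT isT).
  by move=> _; apply: fI; apply: uniqw.
by have := leq_card g gI; rewrite !card_ord.
Qed.

Lemma unclasped_same_color (V : Type) l (U : graph V) (E : set V) (c : V -> 'I_3) :
  unclasped_lanyard l U E -> (forall x y, adj U x y -> c x <> c y) ->
  forall x y, E x -> E y -> c x = c y.
Proof.
move=> hU; elim: hU => [D F|{}l Y F D F' z _ IH dD EF] cP.
  exact: diamond_same_color cP.
have cF x y : F x -> F y -> c x = c y by apply: IH => u v uv; apply: cP; left.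
have cF' x y : F' x -> F' y -> c x = c y.
  by apply: (diamond_same_color dD) => u v uv; apply: cP; right.
have [Fz Fz'] : (F `&` F') z by rewrite EF.
have cz x : ((F `\` F') `|` (F' `\` F)) x -> c x = c z.
  by case=> -[hx _]; [apply: cF|apply: cF'].
by move=> x y /cz -> /cz ->.
Qed.

Lemma lanyard_not_colorable (V : Type) (X : graph V) :
  contains_diamond_lanyard X -> ~ colorable 3 X.
Proof.
move=> [l [L [dL [_ LX]]]] [c cP].
have {}cP x y : adj L x y -> c x <> c y by move=> /LX/cP.
case: dL cP => {}l U x y hU cP.
have := unclasped_same_color hU (fun u v uv => cP u v (or_introl uv)).
move=> /(_ x y) h; apply: (cP x y); first by right; left.
by apply: h; [left|right].
Qed.

(** * Diamond lanyards, [K_5] and [C_13(1, 5)] inside Cayley graphs *)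

Section CayleyLanyards.
Variables (G : zmodType) (A : set G).
Let S := pm_set A.
Let X := cayley_graph A.
Hypothesis S0 : ~ S 0.

Lemma pm_set_neq0 g : S g -> g <> 0.
Proof. by move=> Sg g0; apply: S0; rewrite -g0. Qed.

(* The diamond has the two remaining vertices [g - q] and [g + p]. *)
Lemma cayley_diamond p q g : S p -> S q -> S (p + q) -> p <> q ->
  exists D, diamond D [set g; g + (p - q)] /\ subgraph D X.
Proof.
move=> Sp Sq Spq pq.
pose s := [:: g; g - q; g + p; g + (p - q)].
pose e (x y : G) := [/\ x \in s, y \in s, x <> y & [set x; y] <> [set g; g + (p - q)]].
have e_sym x y : e x y -> e y x.
  by case=> ? ? xy h; split=> //; [exact: nesym|rewrite setUC].
have evert x y : e x y -> [set` s] x by case.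
have p0 := pm_set_neq0 Sp; have q0 := pm_set_neq0 Sq; have pq0 := pm_set_neq0 Spq.
have d12 : g - (g - q) = q by rewrite opprB addrC subrK.
have d13 : g + p - g = p by rewrite addrC addKr.
have d23 : g + p - (g - q) = p + q by rewrite opprB addrC addrA subrK addrC.
have d24 : g + (p - q) - (g - q) = p.
  by rewrite opprB addrC addrA subrK addrC subrK.
have d34 : g + p - (g + (p - q)) =
  q by rewrite opprD addrACA subrr add0r opprB addrC subrK.
have d12' : g - q - g = - q by rewrite addrC addKr.
have d34' : g + (p - q) - (g + p) = - q by rewrite -opprB d34.
have d14 : g + (p - q) - g = p - q by rewrite addrC addKr.
have pmq0 : p - q <> 0 by move/eqP; rewrite subr_eq0 => /eqP.
have nq0 : - q <> 0 by rewrite -oppr0 => /oppr_inj.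
have nd (u v d : G) : v - u = d -> d <> 0 -> u != v.
  by move=> <- h; apply/eqP => uv; apply: h; rewrite uv subrr.
have su : uniq s.
  rewrite /= !inE !negb_or !andbT.
  by rewrite (nd _ _ _ d12') ?(nd _ _ _ d13) ?(nd _ _ _ d14) ?(nd _ _ _ d23)
    ?(nd _ _ _ d24) ?(nd _ _ _ d34') //.
exists (Graph e_sym evert); split; last first.
  split=> // x y [/= xs ys xy nE].
  have Sdiff (u v : G) : v - u = p \/ v - u = q \/
    v - u = p + q -> S (v - u) /\ S (u - v).
    by move=> h; have Sh : S (v - u) by [case: h => [->|[->|->]]];
       split=> //; rewrite -opprB; apply: pm_setN.
  move: xs ys xy nE; rewrite !inE /X /cayley_graph /=.
  case/or4P=> /eqP-> /or4P[]/eqP-> // xy nE.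
  - by case: (Sdiff (g - q) g); [right; left|].
  - by case: (Sdiff g (g + p)); [left|].
  - by case: (Sdiff (g - q) g); [right; left|].
  - by case: (Sdiff (g - q) (g + p)); [right; right|].
  - by case: (Sdiff (g - q) (g + (p - q))); [left|].
  - by case: (Sdiff g (g + p)); [left|].
  - by case: (Sdiff (g - q) (g + p)); [right; right|].
  - by case: (Sdiff (g + (p - q)) (g + p)); [right; left|].
  - by case: nE; rewrite setUC.
  - by case: (Sdiff (g - q) (g + (p - q))); [left|].
  - by case: (Sdiff (g + (p - q)) (g + p)); [right; left|].
split=> /=.
  have -> : [set` s] = nth g s @` `I_4.
    rewrite eqEsubset; split=> x /=.
      by move=> xs; exists (index x s); [rewrite -index_mem in xs|exact: nth_index].
    by case=> i i4 <-; apply: mem_nth.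
  apply: inj_card_eq => i j; rewrite !inE /= => i4 j4 /eqP.
  by rewrite nth_uniq // => /eqP.
exists g, (g + (p - q)); split=> //.
- by rewrite inE eqxx.
- by rewrite !inE eqxx !orbT.
- by rewrite -{1}[g]addr0 => /addrI/esym/eqP; rewrite subr_eq0 => /eqP.
by move=> u v us vs; split=> [[]|[]].
Qed.

(** The alternative [z = 0] stands for an empty chain, whose two endpoints coincide. *)
Definition lanyard_reach z := z = 0 \/
  exists l U, unclasped_lanyard l U [set 0; z] /\ subgraph U X.

Lemma subgraph_union (Y Z : graph G) :
  subgraph Y X -> subgraph Z X -> subgraph (graph_union Y Z) X.
Proof.
move=> [Yv Ye] [Zv Ze]; split=> [x [/Yv|/Zv]//|x y [/Ye|/Ze]//].
Qed.

(** A chain that falls back on 0 is discarded and started afresh, since consecutive pieces must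
    share exactly one endpoint. *)
Lemma lanyard_reach_step p q z : S p -> S q -> S (p + q) ->
  lanyard_reach z -> lanyard_reach (z + (p - q)).
Proof.
move=> Sp Sq Spq hz.
have [->|pq] := pselect (p = q); first by rewrite subrr addr0.
have d0 : p - q != 0 by rewrite subr_eq0; apply/eqP.
have [D [dD DX]] := cayley_diamond z Sp Sq Spq pq.
have [z0|z0] := pselect (z = 0).
  by right; exists 1%N, D; split=> //; rewrite z0 add0r in dD *;
    exact: unclasped_diamond.
case: hz => // -[l [U [hU UX]]].
have [|zd0] := pselect (z + (p - q) = 0); first by left.
right; exists l.+1, (graph_union U D); split; last exact: subgraph_union.
have zd : z + (p - q) <> z.
  by rewrite -{2}[z]addr0 => /addrI/eqP; apply/negP.
have -> : [set 0; z + (p - q)] = ([set 0; z] `\` [set z; z + (p - q)]) `|`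
    ([set z; z + (p - q)] `\` [set 0; z]).
  rewrite eqEsubset; split=> x.
    case=> ->; [left; split; first by left|right; split; first by right].
      by case=> [/esym|/esym].
    by case.
  by case=> -[[->|->] h]; [left|case: h; left|case: h; right|right].
apply: unclasped_step hU dD _.
rewrite eqEsubset; split=> x; last by move=> ->; split; [right|left].
by case=> -[->|->] // [/esym|/esym].
Qed.

Lemma lanyard_reach_mul p q z (k : int) : S p -> S q -> S (p + q) ->
  lanyard_reach z -> lanyard_reach (z + (p - q) *~ k).
Proof.
move=> Sp Sq Spq.
have pos (n : nat) u p' q' : S p' -> S q' -> S (p' + q') ->
    lanyard_reach u -> lanyard_reach (u + (p' - q') *+ n).
  move=> Sp' Sq' Spq'; elim: n u => [|n IH] u hu; first by rewrite addr0.
  by rewrite mulrS addrA; apply: IH; apply: lanyard_reach_step.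
case: k => n hz; first exact: pos.
by rewrite NegzE mulrNz -mulNrz opprB; apply: pos; rewrite // addrC.
Qed.

Lemma lanyard_of_reach s : S s -> lanyard_reach s -> contains_diamond_lanyard X.
Proof.
move=> Ss [/(pm_set_neq0 Ss)//|[l [U [hU UX]]]].
exists l, (add_edge U 0 s); split; first exact: clasp.
apply: subgraph_union => //; split=> // x y /=.
case=> -[-> ->]; first by rewrite subr0.
by rewrite sub0r; apply: pm_setN.
Qed.

(** The triangle yields diamonds with endpoint displacements [p - q] and [p - r]. A chain of these
    leads from 0 to [s], and the edge from 0 to [s] clasps it. *)
Lemma triangle_lanyard p q r (i j : int) s : S p -> S q -> S r ->
  p + q + r = 0 -> S s -> s = (p - q) *~ i + (p - r) *~ j ->
  contains_diamond_lanyard X.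
Proof.
move=> Sp Sq Sr pqr Ss sE; apply: (lanyard_of_reach Ss).
have Spq : S (p + q).
  have -> : p + q = - r by apply/eqP; rewrite -addr_eq0 pqr.
  exact: pm_setN.
have Spr : S (p + r).
  have -> : p + r = - q by apply/eqP; rewrite -addr_eq0 addrAC pqr.
  exact: pm_setN.
rewrite sE; apply: lanyard_reach_mul => //; rewrite -[_ *~ i]add0r.
by apply: lanyard_reach_mul => //; left.
Qed.

(** The multiples of [a] form [C_5(1, 2)], since [a *+ 3 = - (a *+ 2)] and [a *+ 4 = - a]. *)
Lemma cyclic_complete a : S a -> S (a *+ 2) -> a *+ 5 = 0 ->
  contains_copy (complete_graph 'I_5) X.
Proof.
move=> Sa Sa2 a5.
have Sk k : (0 < k < 5)%N -> S (a *+ k).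
  case: k => [|[|[|[|[|]]]]] // _.
  - have -> : a *+ 3 = - (a *+ 2); last exact: pm_setN.
    by apply/eqP; rewrite -addr_eq0 -mulrnDr a5.
  - have -> : a *+ 4 = - a; last exact: pm_setN.
    by apply/eqP; rewrite -addr_eq0 -mulrSr a5.
have lt (i j : 'I_5) : (j < i)%N -> S (a *+ i - a *+ j).
  move=> ij; rewrite -mulrnBr 1?ltnW //; apply: Sk; rewrite subn_gt0 ij /=.
  by apply: leq_ltn_trans (leq_subr _ _) (ltn_ord i).
have d (i j : 'I_5) : i <> j -> S (a *+ i - a *+ j).
  move=> ij; case: (ltngtP i j) => [ji|ji|e]; last by case: ij; apply: val_inj.
    by rewrite -opprB; apply: pm_setN; apply: lt.
  exact: lt.
exists (fun i : 'I_5 => a *+ i); split=> // [i j _ _ e|i j /= ij].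
  apply: contrapT => /d; rewrite e subrr; exact: S0.
by apply: d; apply: nesym.
Qed.

(** The map [i] to [a *+ i] is injective: as 13 is prime, a Bezout relation turns any coincidence
    into [a = 0]. *)
Lemma cyclic_C13 a : S a -> S (a *+ 5) -> a *+ 13 = 0 ->
  contains_copy C13_1_5 X.
Proof.
move=> Sa Sa5 a13.
have modE k : a *+ (k %% 13) = a *+ k.
  by rewrite {2}(divn_eq k 13) mulrnDr mulnC mulrnA a13 mul0rn add0r.
pose f (i : 'Z_13) : G := a *+ i.
have fD i j : f (i + j) = f i + f j by rewrite /f /= modE mulrnDr.
have f0 : f 0 = 0 by [].
have fB i j : f (i - j) = f i - f j.
  by apply/eqP; rewrite eq_sym subr_eq -fD subrK.
have f1 : f 1 = a by [].
have f5 : f 5 = a *+ 5 by [].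
exists f; split=> // [i j _ _ e|i j].
  have fij : f (i - j) = 0 by rewrite fB e subrr.
  apply: contrapT => ij.
  have ij0 : i - j != 0 by rewrite subr_eq0; apply/eqP.
  have k0 : (0 < (i - j)%R)%N by rewrite lt0n.
  have cop : coprime (i - j)%R 13.
    by rewrite coprime_sym prime_coprime // gtnNdvd.
  have /(coprimeP _ k0)[u uE] := cop.
  have {}uE : (u.1 * (i - j)%R = 1 + u.2 * 13)%N by lia.
  have h1 : a *+ (u.1 * (i - j)%R) = 0.
    by rewrite mulnC mulrnA (fij : a *+ (i - j)%R = 0) mul0rn.
  have h2 : a *+ (1 + u.2 * 13) = a.
    by rewrite mulrnDr (mulnC u.2) mulrnA a13 mul0rn addr0.
  by apply: (pm_set_neq0 Sa); rewrite -h2 -uE.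
have Sf k : k = 1 \/ k = 5 -> S (f k) by case=> ->; rewrite ?f1 ?f5.
by case=> [/Sf|[k /Sf Sk E]]; rewrite /= -fB // -E -sub0r fB f0 sub0r; apply: pm_setN.
Qed.

End CayleyLanyards.

(** * Exhaustive search for a 3-coloring of [C_13(1, 5)] *)

Section C13Search.
Local Open Scope nat_scope.

(* Vertices are coloured in the order 0, ..., 12, most recent first: vertex [i]
   is adjacent to [i - 1], [i - 5], [i - 8] and [i - 12] among its predecessors. *)
Definition back_shifts := [:: 0; 4; 7; 11].

(** This backtracking search succeeds when [s] cannot be extended by [n] more vertices. Position [k]
    of [s] holds the color [k + 1] places back. The default 3 is not a color, so predecessors that
    do not exist forbid nothing. *)
Fixpoint stuck n (s : seq nat) :=
  if n is n'.+1 then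
    all (fun x => if has (fun k => x == nth 3 s k) back_shifts then true
                  else stuck n' (x :: s))
      [:: 0; 1; 2]
  else false.

Fixpoint prefix_colors (d : nat -> nat) i :=
  if i is i'.+1 then d i' :: prefix_colors d i' else [::].

Lemma nth_prefix_colors d i k : nth 3 (prefix_colors d i) k =
  if k < i then d (i - k.+1) else 3.
Proof.
by elim: i k => [|i IH] [|k] //=; rewrite ?subn1 // IH ltnS subSS.
Qed.

Lemma stuck_sound d n i : (forall j, d j < 3) ->
  (forall j k, k \in back_shifts -> k < j -> j < 13 -> d j <> d (j - k.+1)) ->
  i + n = 13 -> stuck n (prefix_colors d i) -> False.
Proof.
move=> d3 dP; elim: n i => [|n IH] i // iE st.
have /allP/(_ (d i)) : all (fun x => if has (fun k =>
    x == nth 3 (prefix_colors d i) k) back_shifts then true else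
    stuck n (x :: prefix_colors d i)) [:: 0; 1; 2] := st.
have -> : d i \in [:: 0; 1; 2] by have := d3 i; rewrite !inE; case: (d i) => [|[|[]]].
move=> /(_ isT); case: ifP => [/hasP[k kb /eqP] + _|_];
  last by apply: (IH i.+1); rewrite // -iE addSnnS.
rewrite nth_prefix_colors; case: ifP => [ki|_] e.
  by apply: (dP i k) => //; rewrite -iE; lia.
by have := d3 i; rewrite e.
Qed.

Lemma stuck13 : stuck 13 [::].
Proof. by vm_compute. Qed.

End C13Search.

Lemma C13_not_colorable (V : Type) (X : graph V) :
  contains_copy C13_1_5 X -> ~ colorable 3 X.
Proof.
move=> cp /(colorable_copy cp)[c cP].
pose d (j : nat) : nat := c (inZp j).
apply: (@stuck_sound d 13 0 _ _ erefl stuck13) => [j|j k kb kj j13 e].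
  exact: ltn_ord.
have e' : c (inZp j) = c (inZp (j - k.+1)) by apply: val_inj.
apply: cP e' => /=.
rewrite -!Zp_nat natrB // addrAC subrr sub0r.
(* Modulo 13, the differences 8 and 12 are [- 5] and [- 1]. *)
move: kb; rewrite !inE => /or4P[] /eqP ->.
- by right; exists 1; first by left.
- by right; exists 5; first by right.
- by left; right; apply: val_inj.
- by left; left; apply: val_inj.
Qed.

(** * The non-3-colorable cases *)

Section BlockColoring.

(* Colours [0 .. N - 1] with blocks 012 and 0123, which exist for N = 3 p + 4 q. *)
Definition block_color (p q : int) (i : int) : nat :=
  let r := (i %% (3 * p + 4 * q))%Z in
  if r < 3 * p then `|(r %% 3)%Z|%N else `|((r - 3 * p) %% 4)%Z|%N.

Lemma modz_shift (N i j : int) : 0 < j -> j < N ->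
  (((i + j) %% N)%Z = (i %% N)%Z + j \/ ((i + j) %% N)%Z = (i %% N)%Z + j - N)
  /\ 0 <= ((i + j) %% N)%Z /\ ((i + j) %% N)%Z < N.
Proof.
move=> j0 jN; have N0 : 0 < N by lia.
have h1 : 0 <= (i %% N)%Z by rewrite modz_ge0 // gt_eqF.
have h2 : (i %% N)%Z < N by apply: ltz_pmod.
split; last by split; [rewrite modz_ge0 // gt_eqF|apply: ltz_pmod].
rewrite -modzDml; move: (i %% N)%Z h1 h2 => r h1 h2.
have [h|h] := ltP (r + j) N; first by left; rewrite modz_small //; lia.
right; rewrite -{1}[r + j](subrK N) modzDr modz_small //; lia.
Qed.

Lemma block_colorP (N : int) : 3 <= N -> N <> 5 ->
  exists f : int -> nat, [/\ forall i, (f i < 4)%N, forall i m, f (i + m * N) = f i,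
    forall i, f (i + 1) <> f i & forall i, f (i + 2) <> f i].
Proof.
move=> N3 N5.
have [p [q [p0 q0 NE]]] : exists p q : int, [/\ 0 <= p, 0 <= q & N = 3 * p + 4 * q].
  (* With [N %% 3] blocks of length 4, the number of blocks of length 3 is nonnegative for every
     [N >= 3] except 5. *)
  by exists ((N - 4 * (N %% 3)%Z) %/ 3)%Z, (N %% 3)%Z; split; lia.
have h0 i : 0 <= (i %% N)%Z < N.
  by rewrite modz_ge0 ?ltz_pmod //; lia.
exists (block_color p q); split=> [i|i m|i|i]; rewrite /block_color -NE.
- by case: ifP; lia.
- by rewrite addrC modzMDl.
- have [] := @modz_shift N i 1; [lia|lia|]; have := h0 i.
  by move: (i %% N)%Z ((i + 1) %% N)%Z => r s; case: ifP; case: ifP; lia.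
- have [] := @modz_shift N i 2; [lia|lia|]; have := h0 i.
  by move: (i %% N)%Z ((i + 2) %% N)%Z => r s; case: ifP; case: ifP; lia.
Qed.

(** For the excluded values [C_N(1, 2)] has a loop or is [K_5]. For [N = 0] any period will do, and
    3 is taken. *)
Lemma block_coloring (N : int) : N \notin [:: 1; 2; 5; - 1; - 2; - 5] ->
  exists f : int -> nat, [/\ forall i, (f i < 4)%N, forall i m, f (i + m * N) = f i,
    forall i, f (i + 1) <> f i & forall i, f (i + 2) <> f i].
Proof.
rewrite !inE => hN.
have [N0|N0] := eqVneq N 0.
  have [//|//|f [f4 _ f1 f2]] := @block_colorP 3.
  by exists f; split=> // i m; rewrite N0 mulr0 addr0.
have [||f [f4 fN f1 f2]] := @block_colorP `|N|; [lia|lia|].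
exists f; split=> // i m.
have [NE|NE] : N = `|N| \/ N = - `|N| by lia.
  by rewrite NE fN.
by rewrite NE mulrN -mulNr fN.
Qed.

End BlockColoring.

(** * Presentations with exceptional relations *)

Section Cases.
Variable G : zmodType.
Implicit Types a b c g : G.

(* A homomorphism to the circulant graph [C_N(1, 2)]. *)
Lemma colorable4_circulant a b c x1 y1 z1 x2 y2 z2 (s t u N k1 k2 : int) :
  presentation a b c x1 y1 z1 x2 y2 z2 ->
  N \notin [:: 1; 2; 5; - 1; - 2; - 5] ->
  s \in [:: 1; 2; - 1; - 2] -> t \in [:: 1; 2; - 1; - 2] -> u \in [:: 1; 2; - 1; - 2] ->
  s * x1 + t * y1 + u * z1 = k1 * N -> s * x2 + t * y2 + u * z2 = k2 * N ->
  colorable 4 (gens_graph a b c).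
Proof.
move=> P /block_coloring[f [f4 fN f1 f2]] hs ht hu e1 e2.
have step (i j : int) : j \in [:: 1; 2; - 1; - 2] -> f (i + j) <> f i.
  rewrite !inE => /or4P[] /eqP ->; [exact: f1|exact: f2| |] => e.
    by apply: (f1 (i - 1)); rewrite subrK e.
  by apply: (f2 (i - 2)); rewrite subrK e.
apply: (colorable_of_periodic (K := fun x y z => f (s * x + t * y + u * z)) P) => //.
- move=> x y z m n.
  rewrite -(fN (s * x + t * y + u * z) (m * k1 + n * k2)); congr f.
  by rewrite mulrDl -!mulrA -e1 -e2; ring.
- move=> x y z; have -> : s * (x + 1) + t * y + u * z =
    s * x + t * y + u * z + s by ring.
  exact: step.
- move=> x y z; have -> : s * x + t * (y + 1) + u * z =
    s * x + t * y + u * z + t by ring.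
  exact: step.
- move=> x y z; have -> : s * x + t * y + u * (z + 1) =
    s * x + t * y + u * z + u by ring.
  exact: step.
Qed.

Lemma gens_pm_set a b c g : (g = a \/ g = b \/ g = c) -> g <> 0 ->
  pm_set (gens a b c) g.
Proof. by move=> h g0; left. Qed.

Lemma gens_pm_set0 a b c : ~ pm_set (gens a b c) 0.
Proof.
case=> [[_]//|[h [_ h0] /eqP]]; rewrite oppr_eq0 => /eqP; exact: h0.
Qed.

(** This form yields both equivalences at once, because each obstruction rules out the corresponding
    coloring in every graph. *)
Definition dichotomy (X : graph G) := colorable 3 X \/
  ((contains_diamond_lanyard X \/ contains_copy C13_1_5 X) /\
   (colorable 4 X \/ contains_copy (complete_graph 'I_5) X)).

Lemma pres_live a b c x1 y1 z1 x2 y2 z2 :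
  presentation a b c x1 y1 z1 x2 y2 z2 ->
  [/\ x1 <> 0 \/ x2 <> 0 -> a <> 0, y1 <> 0 \/ y2 <> 0 -> b <> 0
    & z1 <> 0 \/ z2 <> 0 -> c <> 0].
Proof.
case=> _ _ _ _ [da db dc].
by split=> h e0; [have [e1 e2] := da e0|have [e1 e2] := db e0|have [e1 e2] := dc e0];
   case: h.
Qed.

(** If 3 divides [x + y + z], the coordinate sum itself is a suitable functional. Otherwise [a - b]
    and [a - c] generate [a], since [a *~ 3] and [a *~ (x + y + z)] are combinations of them. *)
Lemma dichotomy_triangle a b c x y z :
  presentation a b c 1 1 1 x y z -> dichotomy (gens_graph a b c).
Proof.
move=> P; have [la lb lc] := pres_live P.
have a0 : a <> 0 by apply: la; left.
have b0 : b <> 0 by apply: lb; left.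
have c0 : c <> 0 by apply: lc; left.
have abc : a + b + c = 0 by have := pres_rel1 P; rewrite /comb !mulr1z.
have rel := pres_rel2 P.
have relE : a *~ (x + y + z) = (a - b) *~ y + (a - c) *~ z.
  have e (g : G) (k : int) : a *~ k =
    g *~ k + (a - g) *~ k by rewrite -mulrzDl addrC subrK.
  by rewrite !mulrzDr (e b y) (e c z) (addrA (a *~ x)) addrACA [X in X + _](rel : comb a b c x y z = 0) add0r.
have tripl : a *~ 3 = (a - b) + (a - c).
  rewrite addrACA -opprD; have -> : b + c = - a.
    by apply/eqP; rewrite -addr_eq0 addrC addrA abc.
  by rewrite opprK -[in LHS](_ : 1 + 1 + 1 = 3) // !mulrzDr !mulr1z.
have [sE|sN] := pselect (exists q, x + y + z = 3 * q).
  left; apply: colorable3_of_functional P _.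
  have [q qE] := sE; exists 1, q; split; [by exists 1|by exists q; rewrite qE; ring|].
  move=> m n; rewrite /norm3 !mulr1.
  have -> : 3 * `|m + n * q| = `|(m + n * x) + (m + n * y) + (m + n * z)|.
    have -> : (m + n * x) + (m + n * y) + (m + n * z) = 3 * (m + n * q).
      by rewrite mulrDr mulrCA -qE; ring.
    by rewrite normrM.
  by apply: le_trans (ler_normD _ _) _; rewrite lerD2r ler_normD.
right; split.
  left.
  have [i [j aE]] : exists i j, a = (a - b) *~ i + (a - c) *~ j.
    have [k [h|h]] : exists k : int, x + y + z = 3 * k + 1 \/ x + y + z = 3 * k - 1.
      exists ((x + y + z + 1) %/ 3)%Z.
      have : ((x + y + z) %% 3)%Z <> 0.
        by move=> h; apply: sN; exists ((x + y + z) %/ 3)%Z; lia.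
      lia.
    - exists (y - k), (z - k); rewrite !mulrzBr addrACA -relE -opprD -mulrzDl -tripl h.
      by rewrite -mulrzA -mulrzBr addrAC subrr add0r mulr1z.
    - exists (k - y), (k - z); rewrite !mulrzBr addrACA -opprD -relE -mulrzDl -tripl h.
      by rewrite -mulrzA -mulrzBr opprB addrC subrK mulr1z.
  by apply: (triangle_lanyard (@gens_pm_set0 a b c) (p := a) (q := b) (r := c)
    _ _ _ abc _ aE); apply: gens_pm_set; auto.
left.
(* The weights [(1, 1, - 2)] and their permutations vanish on [(1, 1, 1)]. Their values on the
   second relation have sum 0 and are congruent to [x + y + z] modulo 3, so if all are excluded they
   are 1, 1, -2 up to order and a common sign. *)
have [h|[h|[h|h]]] : (x + y - 2 * z \notin [:: 1; 2; 5; - 1; - 2; - 5]) \/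
  ((x - 2 * y + z \notin [:: 1; 2; 5; - 1; - 2; - 5]) \/
  ((- 2 * x + y + z \notin [:: 1; 2; 5; - 1; - 2; - 5]) \/
  ((y = z /\ (x = y + 1 \/ x = y - 1)) \/ (x = z /\ (y = x + 1 \/ y = x - 1)) \/
   (x = y /\ (z = x + 1 \/ z = x - 1))))).
- by rewrite !inE; lia.
- by apply: (colorable4_circulant (s := 1) (t := 1) (u := - 2) (k1 := 0) (k2 :=
    1) P h) => //; ring.
- by apply: (colorable4_circulant (s := 1) (t := - 2) (u := 1) (k1 := 0) (k2 :=
    1) P h) => //; ring.
- by apply: (colorable4_circulant (s := - 2) (t := 1) (u := 1) (k1 := 0) (k2 :=
    1) P h) => //; ring.
(* Subtracting a multiple of [a + b + c = 0] from the second relation makes a generator trivial. *)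
exfalso.
have z1 (g : G) : g *~ 1 = 0 \/ g *~ (- 1) = 0 -> g = 0.
  by rewrite mulrNz mulr1z => -[//|/eqP]; rewrite oppr_eq0 => /eqP.
have shift (u : int) : comb a b c (x - u) (y - u) (z - u) = 0.
  by rewrite combB rel /comb -!mulrzDl abc mul0rz subr0.
have rel' := shift y; have rel'' := shift x.
case: h => [[yz h]|[[xz h]|[xy h]]].
- apply: a0; apply: z1; move: rel'; rewrite yz !subrr /comb !mulr0z !addr0.
  by case: h => ->; rewrite yz addrC addKr; auto.
- apply: b0; apply: z1; move: rel''; rewrite xz !subrr /comb !mulr0z add0r !addr0.
  by case: h => ->; rewrite xz addrC addKr; auto.
- apply: c0; apply: z1; move: rel''; rewrite xy !subrr /comb !mulr0z !add0r.
  by case: h => ->; rewrite xy addrC addKr; auto.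
Qed.

(** As [b] is [- (a *+ 2)], the triangle [a], [a], [b] has displacement [a - b = a *~ 3], and the
    second relation reads [a *~ (x - 2 * y) + c *~ z = 0]. The size of [z] decides the case. *)
Lemma dichotomy_double a b c x y z :
  presentation a b c 2 1 0 x y z -> dichotomy (gens_graph a b c).
Proof.
move=> P; have [la lb lc] := pres_live P.
have a0 : a <> 0 by apply: la; left.
have b0 : b <> 0 by apply: lb; left.
have a2b : a *+ 2 = - b.
  have := pres_rel1 P; rewrite /comb mulr0z mulr1z addr0 => /eqP.
  by rewrite addr_eq0 => /eqP.
have tripl : a *~ 3 = a - b by rewrite -a2b -mulrS.
have rel : a *~ (x - 2 * y) + c *~ z = 0.
  rewrite -(pres_rel2 P) /comb mulrzBr mulrzA -mulNrz; congr (_ + _ *~ _ + _).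
  by rewrite [a *~ 2]a2b opprK.
(* The functional is the coordinate sum after [n0] has replaced [z] in the second relation. *)
have good n0 q : x + y + n0 = 3 * q -> `|n0| <= `|z| -> (exists k, z = n0 + 2 * k) ->
    dichotomy (gens_graph a b c).
  move=> qE n0z [k kE]; left; apply: colorable3_of_functional P _.
  exists 1, q; split; [by exists 1|exists (q + k); lia|].
  move=> m n; rewrite /norm3 mulr1 mulr0 add0r.
  have -> : 3 * `|m + n * q| = `|(m * 2 + n * x) + (m + n * y) + n * n0|.
    have -> : (m * 2 + n * x) + (m + n * y) + n * n0 = 3 * (m + n * q).
      have -> : 3 * (m + n * q) = 3 * m + n * (3 * q) by ring.
      by rewrite -qE; ring.
    by rewrite normrM.
  apply: le_trans (ler_normD _ _) _; apply: lerD; first exact: ler_normD.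
  by rewrite !normrM ler_wpM2l.
have Sa : pm_set (gens a b c) a.
  by apply: gens_pm_set; auto.
have Sb : pm_set (gens a b c) b.
  by apply: gens_pm_set; auto.
have aab : a + a + b = 0 by rewrite -mulr2n a2b addNr.
have lanyard s j : pm_set (gens a b c) s ->
    s = (a - b) *~ j -> contains_diamond_lanyard (gens_graph a b c).
  move=> Ss sE; apply: (triangle_lanyard (@gens_pm_set0 a b c) (p := a) (q := a)
    (i := 0) (j := j) Sa Sa Sb aab Ss).
  by rewrite mulr0z add0r.
have [z2|z1] := leP 2 `|z|.
  have [n0 [q [h1 h2 h3]]] : exists n0 q : int,
      [/\ x + y + n0 = 3 * q, `|n0| <= `|z| & exists k, z = n0 + 2 * k].
    (* These candidates cover all residues modulo 3, and [|z| - 4 >= - |z|] because [|z| >= 2]. *)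
    have h : exists n0 q : int, x + y + n0 = 3 * q /\
      ((n0 = `|z|) \/ (n0 = `|z| - 2) \/ (n0 = `|z| - 4)).
      have [h|[h|h]] : ((x + y + `|z|) %% 3)%Z = 0 \/ ((x + y + `|z|) %% 3)%Z = 1 \/
          ((x + y + `|z|) %% 3)%Z = 2 by lia.
      - by exists `|z|, ((x + y + `|z|) %/ 3)%Z; lia.
      - by exists (`|z| - 4), ((x + y + `|z| - 4) %/ 3)%Z; lia.
      - by exists (`|z| - 2), ((x + y + `|z| - 2) %/ 3)%Z; lia.
    have [n0 [q [h1 h2]]] := h; exists n0, q; split=> //; first by lia.
    by exists ((z - n0) %/ 2)%Z; lia.
  exact: good h1 h2 h3.
have [z0|{}z1] : z = 0 \/ (z = 1 \/ z = - 1) by lia.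
  have [sE|sN] := pselect (exists q, x + y = 3 * q).
    have [q qE] := sE; apply: (good 0 q); rewrite ?addr0 ?z0 //.
    by exists 0.
  have {rel} : a *~ (x - 2 * y) = 0 by rewrite -rel z0 mulr0z addr0.
  set X := x - 2 * y => rel.
  have XN : ~ exists q, X = 3 * q.
    by case=> q qE; apply: sN; exists (q + y); rewrite /X in qE; lia.
  right; split.
    left; have [k [h|h]] : exists k : int, X = 3 * k + 1 \/ X = 3 * k - 1.
      exists ((X + 1) %/ 3)%Z.
      have : (X %% 3)%Z <> 0 by move=> h; apply: XN; exists (X %/ 3)%Z; lia.
      by lia.
    - apply: (lanyard a (- k)) => //; rewrite -tripl -mulrzA mulrN.
      by apply/eqP; rewrite mulrNz -addr_eq0 -[X in X + _]mulr1z -mulrzDr addrC -h rel.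
    - apply: (lanyard a k) => //; rewrite -tripl -mulrzA.
      have -> : 3 * k = X + 1 by lia.
      by rewrite mulrzDr rel add0r mulr1z.
  (* Up to sign, [X = 5] gives [K_5], while [X = 1] and [X = 2] would make [a] and [b] trivial,
     respectively. *)
  have [h|[h|[h|h]]] : X \notin [:: 1; 2; 5; - 1; - 2; - 5] \/
    ((X = 5 \/ X = - 5) \/ ((X = 1 \/ X = - 1) \/ (X = 2 \/ X = - 2))).
  - by rewrite !inE; lia.
  - left; apply: (colorable4_circulant (s := 1) (t := - 2) (u := 1) (k1 :=
      0) (k2 := 1) P h) => //;
      by rewrite ?z0 /X; ring.
  - right; apply: (cyclic_complete (@gens_pm_set0 a b c) Sa).
      by rewrite a2b; apply: pm_setN.
    by case: h rel => -> //; rewrite mulrNz => /eqP; rewrite oppr_eq0 => /eqP.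
  - exfalso; apply: a0; move: rel; case: h => ->; rewrite ?mulrNz mulr1z // => /eqP.
    by rewrite oppr_eq0 => /eqP.
  - exfalso; apply: b0; move: rel; case: h => ->;
      rewrite ?mulrNz [a *~ 2]a2b ?opprK // => /eqP.
    by rewrite oppr_eq0 => /eqP.
have c0 : c <> 0 by apply: lc; right; case: z1 => ->.
have [[k kE]|sN] := pselect (exists q, x - 2 * y = 3 * q); last first.
  have [h|h] : ((x + y) %% 3)%Z = 1 \/ ((x + y) %% 3)%Z = 2.
    have : ((x - 2 * y) %% 3)%Z <> 0.
      by move=> h; apply: sN; exists ((x - 2 * y) %/ 3)%Z; lia.
    by lia.
  - apply: (good (- 1) ((x + y - 1) %/ 3)%Z); [lia|lia|].
    by case: z1 => ->; [exists 1|exists 0].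
  - apply: (good 1 ((x + y + 1) %/ 3)%Z); [lia|lia|].
    by case: z1 => ->; [exists 0|exists (- 1)].
have cz : c *~ z = (a - b) *~ (- k).
  rewrite -tripl -mulrzA mulrN -kE mulrNz; apply/eqP.
  by rewrite -addr_eq0 addrC rel.
right; split; left.
  have Sc : pm_set (gens a b c) c.
    by apply: gens_pm_set; auto.
  apply: (lanyard c (- k * z)) => //.
  by rewrite mulrzA -cz -mulrzA; case: z1 => ->; rewrite mulr1z.
have k0 : k <> 0.
  move=> k0; apply: c0; move: cz; rewrite k0 oppr0 mulr0z; case: z1 => ->;
    rewrite ?mulrNz mulr1z // => /eqP.
  by rewrite oppr_eq0 => /eqP.
(* No nonzero [k] is excluded by both values. Giving [c] the weight [z] or [- z] realizes either of
   them. *)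
have [h|h] : 3 * k + 1 \notin [:: 1; 2; 5; - 1; - 2; - 5] \/
  3 * k - 1 \notin [:: 1; 2; 5; - 1; - 2; - 5] by rewrite !inE; lia.
- apply: (colorable4_circulant (s := 1) (t := - 2) (u := z) (k1 := 0) (k2 :=
    1) P h) => //.
  - by case: z1 => ->.
  - by ring.
  - by rewrite mul1r -kE; case: z1 => ->; ring.
- apply: (colorable4_circulant (s := 1) (t := - 2) (u := - z) (k1 := 0) (k2 :=
    1) P h) => //.
  - by case: z1 => ->.
  - by ring.
  - by rewrite mul1r -kE; case: z1 => ->; ring.
Qed.

(** The sum of the relations gives [a *+ 5 = b], and three times the first plus twice the second
    gives [a *+ 13 = 0]. *)
Lemma dichotomy_twisted a b c :
  presentation a b c 3 2 0 2 (- 3) 0 -> dichotomy (gens_graph a b c).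
Proof.
move=> P; have [la lb lc] := pres_live P.
have a0 : a <> 0 by apply: la; left.
have b0 : b <> 0 by apply: lb; left.
have r1 := pres_rel1 P; have r2 := pres_rel2 P.
have b5 : a *+ 5 = b.
  have h : comb a b c (3 + 2) (2 + - 3) (0 + 0) = 0 by rewrite combD r1 r2 addr0.
  have : comb a b c 5 (- 1) 0 = 0 := h.
  rewrite /comb mulr0z addr0 mulrNz mulr1z => /eqP.
  by rewrite subr_eq0 => /eqP.
have a13 : a *+ 13 = 0.
  have h : comb a b c (3 * 3 + 2 * 2) (3 * 2 + 2 * - 3) (3 * 0 + 2 * 0) = 0.
    by rewrite combD !combZ r1 r2 !mul0rz addr0.
  have : comb a b c 13 0 0 = 0 := h.
  by rewrite /comb !mulr0z !addr0.
have Sa : pm_set (gens a b c) a.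
  by apply: gens_pm_set; auto.
right; split; [right|left].
  apply: (cyclic_C13 (@gens_pm_set0 a b c) Sa) => //.
  by rewrite b5; apply: gens_pm_set; auto.
(* [T] is a 4-coloring of [C_13(1, 5)]. The generators [a], [b], [c] are given the weights 1, 5, 1;
   the last is free because [c] does not occur in the relations. *)
pose T := [:: 0; 1; 0; 1; 0; 1; 0; 1; 2; 3; 2; 3; 2]%N.
pose f (i : int) := nth 0%N T `|(i %% 13)%Z|%N.
have cases (i : int) : exists2 r : nat, (i %% 13)%Z = r%:Z & (r < 13)%N.
  by exists `|(i %% 13)%Z|%N; lia.
have f1 i : f (i + 1) <> f i.
  rewrite /f -modzDml; have [r -> r13] := cases i.
  by do 13! [case: r r13 => [//|r r13]].
have f5 i : f (i + 5) <> f i.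
  rewrite /f -modzDml; have [r -> r13] := cases i.
  by do 13! [case: r r13 => [//|r r13]].
have f4 i : (f i < 4)%N.
  by rewrite /f; have [r -> r13] := cases i; do 13! [case: r r13 => [//|r r13]].
apply: (colorable_of_periodic (K := fun x y z => f (x + 5 * y + z)) P) => //.
- move=> x y z m n; rewrite /f; congr (nth _ _ `|_|%N).
  have -> : x + (m * 3 + n * 2) + 5 * (y + (m * 2 + n * - 3)) + (z + (m * 0 + n * 0))
    = (m - n) * 13 + (x + 5 * y + z) by ring.
  by rewrite modzMDl.
- by move=> x y z; have -> : x + 1 + 5 * y + z = x + 5 * y + z + 1 by ring.
- by move=> x y z; have -> : x + 5 * (y + 1) + z = x + 5 * y + z + 5 by ring.
- by move=> x y z; rewrite addrA.
Qed.

(** * Changes of generators and of basis *)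

Lemma presentation_neg1 a b c x1 y1 z1 x2 y2 z2 :
  presentation a b c x1 y1 z1 x2 y2 z2 ->
  presentation (- a) b c (- x1) y1 z1 (- x2) y2 z2.
Proof.
have combN1 x y z : comb (- a) b c (- x) y z = comb a b c x y z.
  by rewrite /comb mulNrz mulrNz opprK.
have a0 : - a = 0 -> a = 0 by move/eqP; rewrite oppr_eq0 => /eqP.
case=> gen r1 r2 ker [da db dc]; split; rewrite ?combN1 //.
- move=> g; have [x [y [z [-> hx hy hz]]]] := gen g.
  by exists (- x), y, z; split; rewrite ?combN1 // => /a0/hx ->; rewrite oppr0.
- move=> x y z; rewrite -[x]opprK combN1 => /ker[m [n [hx hy hz]]].
  exists m, n; split=> // na; rewrite opprK -[x]opprK hx ?opprD ?mulrN //.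
  by move=> a00; apply: na; rewrite a00 oppr0.
- by split=> // /a0/da[-> ->]; rewrite oppr0.
Qed.

Lemma presentation_swap12 a b c x1 y1 z1 x2 y2 z2 :
  presentation a b c x1 y1 z1 x2 y2 z2 ->
  presentation b a c y1 x1 z1 y2 x2 z2.
Proof.
have combC x y z : comb b a c y x z = comb a b c x y z.
  by rewrite /comb (addrC (b *~ y)).
case=> gen r1 r2 ker [da db dc]; split; rewrite ?combC //.
- move=> g; have [x [y [z [-> hx hy hz]]]] := gen g.
  by exists y, x, z; split.
- by move=> y x z; rewrite combC => /ker[m [n [hx hy hz]]]; exists m, n.
Qed.

Lemma presentation_swap23 a b c x1 y1 z1 x2 y2 z2 :
  presentation a b c x1 y1 z1 x2 y2 z2 ->
  presentation a c b x1 z1 y1 x2 z2 y2.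
Proof.
have combC x y z : comb a c b x z y = comb a b c x y z.
  by rewrite /comb addrAC.
case=> gen r1 r2 ker [da db dc]; split; rewrite ?combC //.
- move=> g; have [x [y [z [-> hx hy hz]]]] := gen g.
  by exists x, z, y; split.
- by move=> x z y; rewrite combC => /ker[m [n [hx hy hz]]]; exists m, n.
Qed.

Lemma presentation_basis a b c x1 y1 z1 x2 y2 z2 (s t u v : int) :
  s * v - t * u = 1 \/ s * v - t * u = - 1 ->
  presentation a b c x1 y1 z1 x2 y2 z2 ->
  presentation a b c (s * x1 + t * x2) (s * y1 + t * y2) (s * z1 + t * z2)
    (u * x1 + v * x2) (u * y1 + v * y2) (u * z1 + v * z2).
Proof.
move=> det [gen r1 r2 ker [da db dc]].
have det2 : (s * v - t * u) * (s * v - t * u) = 1 by case: det => ->.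
move: det2; move eE : (s * v - t * u) => e ee.
split=> //.
- by rewrite combD !combZ r1 r2 !mul0rz addr0.
- by rewrite combD !combZ r1 r2 !mul0rz addr0.
- move=> x y z /ker[m [n [hx hy hz]]].
  (* The new coefficients come from the adjugate matrix and the determinant [e], which is its own
     inverse. *)
  have E w1 w2 : m * w1 + n * w2 = e * (m * v - n * u) * (s * w1 + t * w2) +
      e * (n * s - m * t) * (u * w1 + v * w2).
    rewrite -[LHS]mul1r -ee -{1}eE; ring.
  by exists (e * (m * v - n * u)), (e * (n * s - m * t)); rewrite -!E.
- by split=> [/da|/db|/dc] [-> ->]; rewrite !mulr0 addr0.
Qed.

Lemma gens_graphN1 a b c : gens_graph (- a) b c = gens_graph a b c.
Proof.
have sub a' : pm_set (gens (- a') b c) `<=`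
    pm_set (gens a' b c).
  have S g : (g = - a' \/ g = b \/ g = c) /\ g <> 0 ->
      pm_set (gens a' b c) g.
    case=> -[gE|h] g0; last by left; split; auto.
    right; exists a'; last by rewrite gE.
    by split; [left|move=> a0; apply: g0; rewrite gE a0 oppr0].
  by move=> g [/S//|[h /S Sh <-]]; apply: pm_setN.
by apply: cayley_graph_eq; rewrite eqEsubset; split=> //; rewrite -{1}[a]opprK.
Qed.

Lemma gens_graph_swap12 a b c : gens_graph b a c = gens_graph a b c.
Proof.
by congr cayley_graph; rewrite eqEsubset; split=> g [h g0]; split=> //;
  case: h; auto=> -[]; auto.
Qed.

Lemma gens_graph_swap23 a b c : gens_graph a c b = gens_graph a b c.
Proof.
by congr cayley_graph; rewrite eqEsubset; split=> g [h g0]; split=> //;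
  case: h; auto=> -[]; auto.
Qed.

Lemma presentation_abs1 a b c x1 y1 z1 x2 y2 z2 :
  presentation a b c x1 y1 z1 x2 y2 z2 -> exists a' (e : int),
  [/\ presentation a' b c `|x1| y1 z1 (e * x2) y2 z2,
      gens_graph a' b c = gens_graph a b c, e * x1 = `|x1| & e = 1 \/ e = - 1].
Proof.
move=> P; have [x0|x0] := leP 0 x1.
  by exists a, 1; rewrite ger0_norm // !mul1r; split=> //; left.
exists (- a), (- 1); rewrite ltr0_norm // !mulN1r; split=> //; last by right.
  exact: presentation_neg1.
exact: gens_graphN1.
Qed.

Lemma presentation_abs a b c x1 y1 z1 x2 y2 z2 :
  presentation a b c x1 y1 z1 x2 y2 z2 -> exists a' b' c' (e1 e2 e3 : int),
  [/\ presentation a' b' c' `|x1| `|y1| `|z1| (e1 * x2) (e2 * y2) (e3 * z2),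
      gens_graph a' b' c' = gens_graph a b c, e1 * x1 = `|x1| /\ (e1 = 1 \/ e1 = - 1),
      e2 * y1 = `|y1| /\ (e2 = 1 \/ e2 = - 1) & e3 * z1 = `|z1| /\
        (e3 = 1 \/ e3 = - 1)].
Proof.
move=> /presentation_abs1[a' [e1 [/presentation_swap12 P g1 h1 h1']]].
have [b' [e2 [/presentation_swap23/presentation_swap12 Q g2 h2 h2']]] :=
  presentation_abs1 P.
have [c' [e3 [/presentation_swap12/presentation_swap23/presentation_swap12 R g3 h3 h3']]] := presentation_abs1 Q.
exists a', b', c', e1, e2, e3; split=> //.
rewrite -g1 -(gens_graph_swap12 a' b c) -g2 -(gens_graph_swap23 b' a' c).
rewrite -(gens_graph_swap12 b' c a') -g3 (gens_graph_swap12 b' c' a').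
by rewrite (gens_graph_swap23 b' a' c') (gens_graph_swap12 a' b' c').
Qed.

(** Once the first relation is nonnegative, it is [(1, 1, 1)], a permutation of [(2, 1, 0)], or a
    unit vector. A unit vector would make a generator trivial that occurs in a relation. *)
Lemma dichotomy_short a b c x1 y1 z1 x2 y2 z2 :
  presentation a b c x1 y1 z1 x2 y2 z2 -> short_vector x1 y1 z1 ->
  dichotomy (gens_graph a b c).
Proof.
move=> /presentation_abs[a' [b' [c' [e1 [e2 [e3 [P <- _ _ _]]]]]]].
move: P; move: (e1 * x2) (e2 * y2) (e3 * z2) => {x2 y2 z2} x y z;
  rewrite /short_vector /norm3.
move: (normr_ge0 x1) (normr_ge0 y1) (normr_ge0 z1); move: (`|x1|) (`|y1|) (`|z1|).
move=> {x1 y1 z1} X Y Z X0 Y0 Z0 P h.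
have [la lb lc] := pres_live P.
have rel := pres_rel1 P.
have [XYZ [X2 [Y2 Z2]]] : (X + Y + Z = 1 \/ X + Y + Z = 3) /\ X <= 2 /\
  Y <= 2 /\ Z <= 2.
  by case: h => [h|[h1 h2 h3 h4]]; lia.
have xc : X = 0 \/ X = 1 \/ X = 2 by clear -X0 X2; lia.
have yc : Y = 0 \/ Y = 1 \/ Y = 2 by clear -Y0 Y2; lia.
have zc : Z = 0 \/ Z = 1 \/ Z = 2 by clear -Z0 Z2; lia.
clear h X0 Y0 Z0 X2 Y2 Z2.
case: xc yc zc => [?|[?|?]] [?|[?|?]] [?|[?|?]]; subst X Y Z; try (exfalso;
  clear -XYZ; lia).
- by case: lc; [left|move: rel; rewrite /comb mulr1z !mulr0z !add0r].
- by case: lb; [left|move: rel; rewrite /comb mulr1z !mulr0z !addr0 add0r].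
- rewrite -gens_graph_swap12 -gens_graph_swap23 -gens_graph_swap12.
  exact: dichotomy_double (presentation_swap12 (presentation_swap23 (presentation_swap12 P))).
- rewrite -gens_graph_swap12 -gens_graph_swap23.
  exact: dichotomy_double (presentation_swap23 (presentation_swap12 P)).
- by case: la; [left|move: rel; rewrite /comb mulr1z !mulr0z !addr0].
- rewrite -gens_graph_swap23 -gens_graph_swap12.
  exact: dichotomy_double (presentation_swap12 (presentation_swap23 P)).
- exact: dichotomy_triangle P.
- by rewrite -gens_graph_swap12; apply: dichotomy_double (presentation_swap12 P).
- by rewrite -gens_graph_swap23; apply: dichotomy_double (presentation_swap23 P).
- exact: dichotomy_double P.
Qed.

(** After sign changes the first relation is [(3, 2, 0)], and the last clause of [twisted_pair]
    makes the second [(2, - 3, 0)] or its negative. *)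
Lemma dichotomy_twisted_pair a b c x1 y1 z1 x2 y2 z2 :
  presentation a b c x1 y1 z1 x2 y2 z2 -> twisted_pair x1 y1 z1 x2 y2 z2 ->
  dichotomy (gens_graph a b c).
Proof.
move=> /presentation_abs[a' [b' [c' [e1 [e2 [e3 [P <- [h1 h1'] [h2 h2'] [h3 h3']]]]]]]].
case=> [[c0 z0] [x13 x22] [y12 y23] tw].
have z20 : z2 = 0 by apply/eqP; rewrite -normr_eq0 z0.
move: P; rewrite x13 y12 c0 z20 mulr0 => P.
have h : (e1 * x2 = 2 /\ e2 * y2 = - 3) \/ (e1 * x2 = - 2 /\ e2 * y2 = 3).
  have X2 : x2 = 2 \/ x2 = - 2 by clear -x22; lia.
  have Y2 : y2 = 3 \/ y2 = - 3 by clear -y23; lia.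
  have X1 : x1 = 3 \/ x1 = - 3 by clear -x13; lia.
  have Y1 : y1 = 2 \/ y1 = - 2 by clear -y12; lia.
  move: tw h1 h2; clear -X1 X2 Y1 Y2 h1' h2'.
  by case: X2 => ->; case: Y2 => ->; case: X1 => ->; case: Y1 => ->;
    case: h1' => ->; case: h2' => ->; lia.
case: h P => -[-> ->] P; first exact: dichotomy_twisted.
apply: dichotomy_twisted.
have := @presentation_basis _ _ _ _ _ _ _ _ _ 1 0 0 (- 1) _ P.
by rewrite !mul1r !mul0r !mulN1r !add0r !addr0 !opprK ?oppr0; apply; right.
Qed.

Lemma dichotomy_twisted_perm a b c x1 y1 z1 x2 y2 z2 :
  presentation a b c x1 y1 z1 x2 y2 z2 -> twisted_pair_perm x1 y1 z1 x2 y2 z2 ->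
  dichotomy (gens_graph a b c).
Proof.
move=> P [] [] h.
- exact: dichotomy_twisted_pair P h.
- rewrite -gens_graph_swap12; exact: dichotomy_twisted_pair (presentation_swap12 P) h.
- rewrite -gens_graph_swap23; exact: dichotomy_twisted_pair (presentation_swap23 P) h.
- rewrite -gens_graph_swap23 -gens_graph_swap12.
  exact: dichotomy_twisted_pair (presentation_swap12 (presentation_swap23 P)) h.
- rewrite -gens_graph_swap12 -gens_graph_swap23.
  exact: dichotomy_twisted_pair (presentation_swap23 (presentation_swap12 P)) h.
- rewrite -gens_graph_swap12 -gens_graph_swap23 -gens_graph_swap12.
  exact: dichotomy_twisted_pair (presentation_swap12 (presentation_swap23 (presentation_swap12 P))) h.
Qed.

(** * Descent to a reduced basis *)

Lemma norm3_ge0 x y z : 0 <= norm3 x y z.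
Proof. by rewrite /norm3 !addr_ge0. Qed.

(* Replacing a basis vector by a shorter sum or difference terminates at a
   basis to which [lattice_cases] applies. *)
Theorem dichotomy_presentation a b c x1 y1 z1 x2 y2 z2 :
  presentation a b c x1 y1 z1 x2 y2 z2 -> dichotomy (gens_graph a b c).
Proof.
have [n] := ubnP (absz (norm3 x1 y1 z1 + norm3 x2 y2 z2)%R).
elim: n x1 y1 z1 x2 y2 z2 => // n IH x1 y1 z1 x2 y2 z2 le_n P.
have sum_ge0 := addr_ge0 (norm3_ge0 x1 y1 z1) (norm3_ge0 x2 y2 z2).
have Padd : presentation a b c x1 y1 z1 (x1 + x2) (y1 + y2) (z1 + z2).
  have := @presentation_basis _ _ _ _ _ _ _ _ _ 1 0 1 1 (or_introl _) P.
  by rewrite !mul1r !mul0r !addr0; apply.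
have Padd' : presentation a b c (x1 + x2) (y1 + y2) (z1 + z2) x2 y2 z2.
  have := @presentation_basis _ _ _ _ _ _ _ _ _ 1 1 0 1 (or_introl _) P.
  by rewrite !mul1r !mul0r !add0r; apply.
have Psub : presentation a b c x1 y1 z1 (x1 - x2) (y1 - y2) (z1 - z2).
  have := @presentation_basis _ _ _ _ _ _ _ _ _ 1 0 1 (- 1) (or_intror _) P.
  by rewrite !mul1r !mul0r !addr0 !mulN1r; apply.
have Psub' : presentation a b c (x1 - x2) (y1 - y2) (z1 - z2) x2 y2 z2.
  have := @presentation_basis _ _ _ _ _ _ _ _ _ 1 (- 1) 0 1 (or_introl _) P.
  by rewrite !mul1r !mul0r !add0r !mulN1r; apply.
have lt_n (s t : int) : 0 <= s -> s < t ->
  t = norm3 x1 y1 z1 + norm3 x2 y2 z2 -> (`|s| < n)%N.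
  by move=> s0 st tE; move: le_n; rewrite -tE; clear -s0 st; lia.
have descent x1' y1' z1' x2' y2' z2' : presentation a b c x1' y1' z1' x2' y2' z2' ->
    norm3 x1' y1' z1' + norm3 x2' y2' z2' < norm3 x1 y1 z1 + norm3 x2 y2 z2 ->
    dichotomy (gens_graph a b c).
  move=> P' lt; apply: IH P'; apply: lt_n lt erefl.
  by rewrite addr_ge0 ?norm3_ge0.
have [h1|h1] := ltP (norm3 (x1 - x2) (y1 - y2) (z1 - z2)) (norm3 x2 y2 z2).
  by apply: descent Psub _; rewrite ltrD2l.
have [h2|h2] := ltP (norm3 (x1 - x2) (y1 - y2) (z1 - z2)) (norm3 x1 y1 z1).
  by apply: descent Psub' _; rewrite ltrD2r.
have [h3|h3] := ltP (norm3 (x1 + x2) (y1 + y2) (z1 + z2)) (norm3 x2 y2 z2).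
  by apply: descent Padd _; rewrite ltrD2l.
have [h4|h4] := ltP (norm3 (x1 + x2) (y1 + y2) (z1 + z2)) (norm3 x1 y1 z1).
  by apply: descent Padd' _; rewrite ltrD2r.
have [good|tw|short1|short2] := lattice_cases h1 h2 h3 h4.
- by left; apply: colorable3_of_functional P good.
- exact: dichotomy_twisted_perm P tw.
- exact: dichotomy_short P short1.
- have := @presentation_basis _ _ _ _ _ _ _ _ _ 0 1 1 0 (or_intror _) P.
  rewrite !mul1r !mul0r !add0r !addr0 => /(_ erefl) P'.
  exact: dichotomy_short P' short2.
Qed.

End Cases.

Lemma dichotomy_iff (G : zmodType) (X : graph G) : dichotomy X ->
  (colorable 4 X <-> ~ contains_copy (complete_graph 'I_5) X) /\
  (colorable 3 X <-> ~ contains_diamond_lanyard X /\ ~ contains_copy C13_1_5 X).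
Proof.
move=> d; split; split.
- by move=> col4 k5; apply: complete_not_colorable k5 col4.
- by move=> nk5; case: d => [/(colorable_leq (isT : (3 <= 4)%N))|[_ []]].
- move=> col3; split=> h; [exact: lanyard_not_colorable h col3|exact: C13_not_colorable h col3].
- by case=> nl n13; case: d => // -[[]].
Qed.

(** * Heuberger matrices *)

Section Heuberger.
Variables (m : nat) (M : 'M[int]_(m, 2)).

Lemma col_subgroupP (v : 'cV[int]_m) :
  v \in col_subgroup M <-> exists p q : int, v = col 0 M *~ p + col 1 M *~ q.
Proof.
split=> [/asboolP[f ->]|[p [q ->]]].
  exists (f 0), (f 1); rewrite big_ord_recl big_ord1 -!(tnth_nth 0) !tnth_mktuple.
  by congr (_ + col _ _ *~ f _); apply: val_inj.
apply/asboolP; exists [ffun i => if i == 0 then p else q].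
by rewrite big_ord_recl big_ord1 -!(tnth_nth 0) !tnth_mktuple !ffunE /=;
  congr (_ + col _ _ *~ _); apply: val_inj.
Qed.

Definition coset (v : 'cV[int]_m) : heuberger_group M :=
  (\pi_(Quotient.quot (col_subgroup M)) v)%qT.

Lemma cosetB u v : coset (u - v) = coset u - coset v.
Proof. by rewrite /coset raddfB. Qed.

Lemma coset0 : coset 0 = 0.
Proof. by have := cosetB 0 0; rewrite !subrr. Qed.

Lemma cosetN v : coset (- v) = - coset v.
Proof. by have := cosetB 0 v; rewrite coset0 !sub0r. Qed.

Lemma cosetD u v : coset (u + v) = coset u + coset v.
Proof. by have := cosetB u (- v); rewrite cosetN !opprK. Qed.

Lemma cosetMz v (k : int) : coset (v *~ k) = coset v *~ k.
Proof.
have pos n : coset (v *+ n) = coset v *+ n.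
  by elim: n => [|n IH]; [rewrite !mulr0n coset0|rewrite !mulrS cosetD IH].
by case: k => n; [exact: pos|rewrite NegzE !mulrNz cosetN; congr (- _); exact: pos].
Qed.

Lemma coset0P v : coset v = 0 <-> exists p q : int, v = col 0 M *~ p + col 1 M *~ q.
Proof.
rewrite -col_subgroupP -{2}[v]subr0 Quotient.idealrBE -coset0.
by split=> [e|/eqP//]; apply/eqP.
Qed.

Lemma coset_surj (g : heuberger_group M) : exists v, g = coset v.
Proof. by exists (repr g); rewrite /coset reprK. Qed.

Lemma basis_cosetE (j : 'I_m) : basis_coset M j = coset (delta_mx j 0).
Proof. by []. Qed.

Lemma coset_sum (v : 'cV[int]_m) :
  coset v = \sum_j basis_coset M j *~ v j 0.
Proof.
have sum (F : 'I_m -> 'cV[int]_m) : coset (\sum_j F j) = \sum_j coset (F j).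
  exact: (big_morph coset cosetD coset0).
rewrite {1}[v]matrix_sum_delta sum; apply: eq_bigr => j _.
by rewrite big_ord1 basis_cosetE -cosetMz -scaler_int intz.
Qed.

Lemma relationE (v : 'cV[int]_m) (p q : int) :
  v = col 0 M *~ p + col 1 M *~ q <->
  forall j, v j 0 = p * M j 0 + q * M j 1.
Proof.
have e j : (col 0 M *~ p + col 1 M *~ q) j 0 = p * M j 0 + q * M j 1.
  by rewrite mxE -!scaler_int !mxE !intz.
split=> [-> //|h]; apply/matrixP => j k; rewrite (ord1 k) e; exact: h.
Qed.

Lemma heuberger_loopless j : loopless (heuberger_graph M) -> basis_coset M j <> 0.
Proof.
by move=> nl h; apply: (nl 0) => /=; left; exists j => //; rewrite subrr.
Qed.

End Heuberger.

(** The third generator is 0, with coordinate 0 throughout; the absence of loops makes the other two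
    nontrivial. *)
Lemma heuberger2 (M : 'M[int]_(2, 2)) : loopless (heuberger_graph M) ->
  dichotomy (heuberger_graph M).
Proof.
move=> nl.
have b0 j := heuberger_loopless (j := j) nl.
have -> : heuberger_graph M = gens_graph (basis_coset M 0) (basis_coset M 1) 0.
  congr cayley_graph; rewrite eqEsubset; split=> g.
    case=> j _ <-; split; last exact: b0.
    by case: (unliftP 0 j) => [k ->|->]; [right; left; congr basis_coset;
      rewrite (ord1 k); apply: val_inj|left].
  by case=> -[->|[->|->]].
have combE x y z : comb (basis_coset M 0) (basis_coset M 1) 0 x y z =
    coset M (\col_j (if j == 0 then x else y)).
  rewrite coset_sum big_ord_recl big_ord1 !mxE /comb mul0rz addr0 /=.
  by congr (_ + basis_coset M _ *~ _); apply: val_inj.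
apply: (@dichotomy_presentation _ _ _ _ (M 0 0) (M 1 0) 0 (M 0 1) (M 1 1) 0); split.
- move=> g; have [v ->] := coset_surj g; exists (v 0 0), (v 1 0), 0; split=> //.
  + rewrite combE; congr coset; apply/matrixP => i k; rewrite (ord1 k) mxE.
    by case: eqP => [->//|/eqP i0]; congr (v _ 0); apply/val_inj; case: i i0 => [[|[]]].
  + by move/(b0 0).
  + by move/(b0 1).
- rewrite combE; apply/coset0P; exists 1, 0; apply/relationE => j;
    rewrite mxE mul1r mul0r addr0.
  by case: eqP => [->//|/eqP j0]; congr (M _ 0); apply/val_inj; case: j j0 => [[|[]]].
- rewrite combE; apply/coset0P; exists 0, 1; apply/relationE => j;
    rewrite mxE mul1r mul0r add0r.
  by case: eqP => [->//|/eqP j0]; congr (M _ 1); apply/val_inj; case: j j0 => [[|[]]].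
- move=> x y z; rewrite combE => /coset0P[p [q /relationE h]]; exists p, q; split=> //.
  + by move=> _; have := h 0; rewrite mxE.
  + by move=> _; have := h 1; rewrite mxE.
- by split=> // [/(b0 0)|/(b0 1)].
Qed.

Lemma heuberger3 (M : 'M[int]_(3, 2)) : loopless (heuberger_graph M) ->
  dichotomy (heuberger_graph M).
Proof.
move=> nl.
have b0 j := heuberger_loopless (j := j) nl.
pose j2 : 'I_3 := ord_max.
have I3 (P : 'I_3 -> Prop) : P 0 -> P 1 -> P j2 -> forall j, P j.
  move=> P0 P1 P2 [[|[|[|//]]] lt].
  - by rewrite (_ : Ordinal lt = 0) //; apply: val_inj.
  - by rewrite (_ : Ordinal lt = 1) //; apply: val_inj.
  - by rewrite (_ : Ordinal lt = j2) //; apply: val_inj.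
have -> : heuberger_graph M = gens_graph (basis_coset M 0) (basis_coset M 1) (basis_coset M j2).
  congr cayley_graph; rewrite eqEsubset; split=> g.
    case=> j _ <-; split; last exact: b0.
    by move: j; apply: I3; auto.
  by case=> -[->|[->|->]].
pose vec (x y z : int) : 'cV[int]_3 :=
  \col_(j < 3) (if j == 0 then x else if j == 1 then y else z).
have combE x y z : comb (basis_coset M 0) (basis_coset M 1) (basis_coset M j2) x y z =
    coset M (vec x y z).
  rewrite coset_sum !big_ord_recl big_ord0 !mxE /comb addr0 /= addrA.
  by congr (_ + basis_coset M _ *~ _ + basis_coset M _ *~ _); apply: val_inj.
apply: (@dichotomy_presentation _ _ _ _ (M 0 0) (M 1 0) (M j2 0) (M 0 1) (M 1 1) (M j2 1)); split.
- move=> g; have [v ->] := coset_surj g; exists (v 0 0), (v 1 0), (v j2 0).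
  split; [|by move/b0..].
  rewrite combE; congr coset; apply/matrixP => i k; rewrite (ord1 k) mxE.
  by move: i; apply: I3.
- rewrite combE; apply/coset0P; exists 1, 0; apply/relationE => j;
    rewrite mxE mul1r mul0r addr0.
  by move: j; apply: I3.
- rewrite combE; apply/coset0P; exists 0, 1; apply/relationE => j;
    rewrite mxE mul1r mul0r add0r.
  by move: j; apply: I3.
- move=> x y z; rewrite combE => /coset0P[p [q /relationE h]]; exists p, q.
  by split=> _; [have := h 0|have := h 1|have := h j2]; rewrite mxE.
- by split=> /b0.
Qed.

Local Close Scope classical_set_scope.
Local Close Scope ring_scope.

Theorem mainTheorem3 (m : nat) (hm : m = 2 \/ m = 3) (M : 'M[int]_(m, 2))
    (hX : loopless (heuberger_graph M)) :
  (colorable 4 (heuberger_graph M) <->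
     ~ contains_copy (complete_graph 'I_5) (heuberger_graph M)) /\
  (colorable 3 (heuberger_graph M) <->
     ~ contains_diamond_lanyard (heuberger_graph M) /\
     ~ contains_copy C13_1_5 (heuberger_graph M)).
Proof.
apply: dichotomy_iff.
by case: hm => e; subst m; [apply: heuberger2|apply: heuberger3].
Qed.
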